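(* Let $K^{+}(z)=M$ and let $K(z)$ be a diagonal matrix $K(z)=\mathrm{diag}(\alpha,\dots,\alpha,\beta,\dots,\beta)$ with parameters $(\xi,\mathcal M)$ as described in the context. Then the open-chain transfer matrix $b(z)=\mathrm{tr}\big(K^+(z)\mathcal B(z)\big)$ obeys $$[\mathcal B(0),\,b(z)]=[\widehat{\mathcal B}(\infty),\,b(z)]=0,$$ i.e. $b(z)$ commutes with the matrix entries of $\mathcal B(0)$ and of $\widehat{\mathcal B}(\infty)$. Hence, the open spin chain admits a finite dimensional $\mathcal U_q(gl(\mathcal N-\mathcal M))\oplus\mathcal U_q(gl(\mathcal M))$ symmetry algebra.
   Context: $q$ is the deformation parameter and $E_{ab}$ are the elementary $\mathcal N\times\mathcal N$ matrices. The $R$-matrix is $$R_{12}(z)=\mathfrak a(z)\sum_{a}E_{aa}\otimes E_{aa}+\mathfrak b(z)\sum_{a\ne b}E_{aa}\otimes E_{bb}+(q-q^{-1})\sum_{a\neq b}z^{\mathrm{sgn}(b-a)}E_{ab}\otimes E_{ba},$$ with $\mathfrak a(z)=qz-q^{-1}z^{-1}$, $\mathfrak b(z)=z-z^{-1}$. $\widehat{\mathcal U}_q=\mathcal U_q(\widehat{gl}(\mathcal N))$ at central charge $c=0$ is generated by the coefficients of $\mathcal L^{\pm}(z)=\sum_{n\ge0}\sum_{a,b}z^{\pm2n}E_{ab}\otimes L_{ab}^{(\pm n)}$ with relations $R_{12}(\frac zw)\mathcal L_1^{\pm}(z)\mathcal L_2^{\pm}(w)=\mathcal L_2^{\pm}(w)\mathcal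 L_1^{\pm}(z)R_{12}(\frac zw)$, $R_{12}(\frac zw)\mathcal L_1^{+}(z)\mathcal L_2^{-}(w)=\mathcal L_2^{-}(w)\mathcal L_1^{+}(z)R_{12}(\frac zw)$, $L^{(+0)}_{ab}=L^{(-0)}_{ba}=0$ for $a<b$, and $L^{(+0)}_{aa}L^{(-0)}_{aa}=L^{(-0)}_{aa}L^{(+0)}_{aa}=1$. The level-zero generators $\ell^{\mp}_{ab}=L^{(\pm0)}_{ab}$ generate the finite dimensional $\mathcal U_q(gl(\mathcal N))$ algebra. For $N$ sites put $\mathcal T^{\pm}_0(z)=\mathcal L^{\pm}_{01}(z)\cdots\mathcal L^{\pm}_{0N}(z)$, where $0$ labels the auxiliary space $\mathbb C^{\mathcal N}$ and $1,\dots,N$ label copies of $\widehat{\mathcal U}_q$; it satisfies the same relations. Diagonal $K$-matrix with parameters $(\xi,\mathcal M)$: $K(z)=\mathrm{diag}(\alpha,\dots,\alpha,\beta,\dots,\beta)$ with $\mathcal M$ entries $\alpha=z^2(z^2-\xi^2)$ followed by $\mathcal N-\mathcal M$ entries $\beta=1-\xi^2z^2$, where $\xi$ is a free parameter characterizing the boundary. Open monodromy matrix: $\mathcal B(z)=\mathcal T^+(z)\,K(z)\,\mathcal T^-(z^{-1})^{-1}$, a power series in $z^2$; it satisfies the reflection equation $R_{12}(\frac zw)\mathcal B_1(z)R_{21}(zw)\mathcal B_2(w)=\mathcal B_2(w)R_{12}(zw)\mathcal B_1(z)R_{21}(\frac zw)$, where $R_{21}$ is $R_{12}$ with the two spaces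 exchanged. Put $\widehat{\mathcal B}(z)=z^{-2}\mathcal B(z^{-1})^{-1}$, which is expanded as a series in $z^{-2}$; $\widehat{\mathcal B}(\infty)$ is its constant term. $M=\sum_{a=1}^{\mathcal N}\theta_0\,q^{\mathcal N-2a+1}E_{aa}$, $\theta_0=\pm1$. The trace is over the auxiliary space. The entries of $\mathcal B(0)$ (resp. $\widehat{\mathcal B}(\infty)$) generate, up to allowing square roots and inverses of some generators, the algebra $\mathcal U_q(gl(\mathcal N-\mathcal M))$ built on the $\ell^{\pm}_{ij}$ with $i,j>\mathcal M$ (resp. $\mathcal U_q(gl(\mathcal M))$ built on the $\ell^{\pm}_{ij}$ with $i,j\le\mathcal M$); these two subalgebras commute with each other. ''Symmetry algebra'' means an algebra of elements commuting with $b(z)$. *)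

(* Defs.v *)
From HB Require Import structures.
From mathcomp Require Import all_boot all_order all_algebra.
From mathcomp Require Import mxtens.
From mathcomp Require Import boolp classical_sets.

Set Implicit Arguments.
Unset Strict Implicit.
Unset Printing Implicit Defensive.

Import Order.TTheory GRing.Theory Num.Theory.
Local Open Scope ring_scope.

(* Coefficients of z^k in qz - q^-1 z^-1 and in z - z^-1. *)
Definition acoef (F : fieldType) (q : F) (k : int) : F :=
  q *+ (k == 1) - q^-1 *+ (k == -1).
Definition bcoef (F : fieldType) (k : int) : F :=
  1 *+ (k == 1) - 1 *+ (k == -1).

(* The matrix coefficient of z^k in the Laurent polynomial R_12(z); it vanishes
   unless k = 1 or k = -1. *)
Definition Rcoef (F : fieldType) (q : F) (n : nat) (k : int) : 'M[F]_(n * n) :=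
  acoef q k *: (\sum_(a < n) delta_mx a a *t delta_mx a a)
  + bcoef F k *: (\sum_(a < n) \sum_(b < n | a != b) delta_mx a a *t delta_mx b b)
  + (q - q^-1) *: (\sum_(a < n) \sum_(b < n | a != b)
       (k == Num.sg (b%:Z - a%:Z))%:R *: (delta_mx a b *t delta_mx b a)).

Section Algebra.
Variables (F : fieldType) (A : algType F).

Definition scalmx (r c : nat) (X : 'M[F]_(r, c)) : 'M[A]_(r, c) :=
  map_mx (in_alg A) X.

Definition inj1 (n : nat) (X : 'M[A]_n) : 'M[A]_(n * n) := X *t (1%:M : 'M[A]_n).
Definition inj2 (n : nat) (X : 'M[A]_n) : 'M[A]_(n * n) := (1%:M : 'M[A]_n) *t X.

(* A sequence L : nat -> 'M_n holds the coefficients of a series in z^2 (for L^+)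
   or in z^-2 (for L^-); below, the coefficient of z^k in that series. *)
Definition zcoef_plus (n : nat) (L : nat -> 'M[A]_n) (k : int) : 'M[A]_n :=
  if k is Posz j then (if odd j then 0 else L j./2) else 0.
Definition zcoef_minus (n : nat) (L : nat -> 'M[A]_n) (k : int) : 'M[A]_n :=
  zcoef_plus L (- k).

(* R_12(z/w) X_1(z) Y_2(w) = Y_2(w) X_1(z) R_12(z/w), coefficientwise: both sides
   are the coefficients of z^i w^j. *)
Definition RLL (q : F) (n : nat) (X Y : int -> 'M[A]_n) : Prop :=
  forall i j : int,
    \sum_(k <- [:: 1; -1])
       scalmx (Rcoef q n k) *m inj1 (X (i - k)) *m inj2 (Y (j + k))
    = \sum_(k <- [:: 1; -1])
       inj2 (Y (j + k)) *m inj1 (X (i - k)) *m scalmx (Rcoef q n k).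

Definition level_zero (n : nat) (Lp0 Lm0 : 'M[A]_n) : Prop :=
  (forall a b : 'I_n, (a < b)%N -> Lp0 a b = 0 /\ Lm0 b a = 0) /\
  (forall a : 'I_n, Lp0 a a * Lm0 a a = 1 /\ Lm0 a a * Lp0 a a = 1).

(* The matrices Lp k = (L_ab^(+k)) and Lm k = (L_ab^(-k)) satisfy the defining
   relations of U_q(gl^(n)) at c = 0, i.e. they define an algebra morphism from
   that algebra to A. *)
Definition Uqglhat_rel (q : F) (n : nat) (Lp Lm : nat -> 'M[A]_n) : Prop :=
  [/\ RLL q (zcoef_plus Lp) (zcoef_plus Lp),
      RLL q (zcoef_minus Lm) (zcoef_minus Lm),
      RLL q (zcoef_plus Lp) (zcoef_minus Lm)
    & level_zero (Lp 0%N) (Lm 0%N)].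

Definition RLL0 (n : nat) (R : 'M[F]_(n * n)) (X Y : 'M[A]_n) : Prop :=
  scalmx R *m inj1 X *m inj2 Y = inj2 Y *m inj1 X *m scalmx R.

(* Defining relations of the finite dimensional U_q(gl(n)) for the matrices
   lm = (l^-_ab) = L^(+0) and lp = (l^+_ab) = L^(-0): the level-zero part of the
   relations above. *)
Definition Uqgl_rel (q : F) (n : nat) (lm lp : 'M[A]_n) : Prop :=
  [/\ forall k : int, RLL0 (Rcoef q n k) lm lm,
      forall k : int, RLL0 (Rcoef q n k) lp lp,
      RLL0 (Rcoef q n (-1)) lm lp
    & level_zero lm lp].

(* Power series with matrix coefficients, as coefficient sequences. *)
Definition smul (n : nat) (X Y : nat -> 'M[A]_n) (k : nat) : 'M[A]_n :=
  \sum_(i < k.+1) X i *m Y (k - i)%N.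
Definition smon (n d : nat) (k : nat) : 'M[A]_n := (k == d)%:R%:M.

(* The two-sided solution Y of X Y = Y X = u^d, u being the variable: the series
   u^d X^-1, unique when it exists (u is central and regular). *)
Definition sinv (n d : nat) (X : nat -> 'M[A]_n) : nat -> 'M[A]_n :=
  xget (fun=> 0) (fun Y : nat -> 'M[A]_n =>
    smul X Y =1 smon n d /\ smul Y X =1 smon n d).

(* T(z) = L_01(z) ... L_0N(z). *)
Definition monodromy (n N : nat) (L : 'I_N -> nat -> 'M[A]_n) : nat -> 'M[A]_n :=
  \big[@smul n/smon n 0]_(s < N) L s.

(* Diagonal entries of K(z), as polynomials in z^2; the first m are alpha and the
   last p are beta. *)
Definition Kentry (m p : nat) (xi : F) (a : 'I_(m + p)) : {poly F} :=
  if (a < m)%N then 'X * ('X - (xi ^+ 2)%:P) else 1 - xi ^+ 2 *: 'X.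
Definition Kmx (m p : nat) (xi : F) (k : nat) : 'M[F]_(m + p) :=
  diag_mx (\row_a (Kentry xi a)`_k).

(* M = sum_a theta0 q^(n - 2a + 1) E_aa, a running from 1 to n; the index a below
   starts from 0. *)
Definition Kplus (q theta0 : F) (n : nat) : 'M[F]_n :=
  diag_mx (\row_a (theta0 * q ^ (n%:Z - 2 * (a.+1)%:Z + 1))).

(* B(z) = T^+(z) K(z) T^-(z^-1)^-1 as a series in z^2. *)
Definition openB (m p : nat) (xi : F) (Tp Tm : nat -> 'M[A]_(m + p)) :
    nat -> 'M[A]_(m + p) :=
  smul (smul Tp (fun k => scalmx (Kmx m p xi k))) (sinv 0 Tm).

(* z^-2 B(z^-1)^-1 as a series in z^-2. As K(0) is singular, B(z)^-1 is only a
   Laurent series, whence the definition by X(z) B(z^-1) = B(z^-1) X(z) = z^-2. *)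
Definition openBhat (m p : nat) (xi : F) (Tp Tm : nat -> 'M[A]_(m + p)) :
    nat -> 'M[A]_(m + p) :=
  sinv 1 (openB xi Tp Tm).

(* b(z) = tr (K^+ B(z)), as a series in z^2. *)
Definition transfer (q theta0 : F) (n : nat) (B : nat -> 'M[A]_n) (k : nat) : A :=
  \tr (scalmx (Kplus q theta0 n) *m B k).

Definition entries (n : nat) (X : 'M[A]_n) (x : A) : Prop :=
  exists i, exists j, x = X i j.
Definition diag_entries (n : nat) (X : 'M[A]_n) (x : A) : Prop :=
  exists i, x = X i i.

Definition subalg (S : A -> Prop) : Prop :=
  [/\ forall c : F, S c%:A,
      forall x y, S x -> S y -> S (x + y)
    & forall x y, S x -> S y -> S (x * y)].

(* The unital subalgebra generated by G. *)
Definition alg_gen (G : A -> Prop) (x : A) : Prop :=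
  forall S, subalg S -> (forall y, G y -> S y) -> S x.

(* The same, allowing square roots and inverses: only those square roots that lie
   in D are adjoined, and only elements of D are inverted. (Allowing every square
   root would adjoin unrelated elements, such as all involutions of A.) *)
Definition alg_gen_sqrt_inv (D G : A -> Prop) (x : A) : Prop :=
  forall S, subalg S ->
    (forall y, D y -> S (y ^+ 2) -> S y) ->
    (forall y y', D y -> S y -> y * y' = 1 -> y' * y = 1 -> S y') ->
    (forall y, G y -> S y) -> S x.

(* The subalgebra generated by the entries l^-_ij, l^+_ij. *)
Definition Uqgl_alg (n : nat) (lm lp : 'M[A]_n) : A -> Prop :=
  alg_gen (fun x => entries lm x \/ entries lp x).

(* The symmetry algebra U_q(gl(p)) (+) U_q(gl(m)) of the series b, its summands
   being built on l^+-_ij with i, j > m, resp. i, j <= m, and generated up to square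
   roots and inverses by the entries of B0, resp. Binf. *)
Definition Uqgl_sum_symmetry (q : F) (m p : nat) (lm lp : 'M[A]_(m + p))
    (B0 Binf : 'M[A]_(m + p)) (b : nat -> A) : Prop :=
  let lm1 := drsubmx lm in let lp1 := drsubmx lp in
  let lm2 := ulsubmx lm in let lp2 := ulsubmx lp in
  [/\ Uqgl_rel q lm1 lp1 /\ Uqgl_rel q lm2 lp2,
      forall x y, Uqgl_alg lm1 lp1 x -> Uqgl_alg lm2 lp2 y -> GRing.comm x y,
      forall x, alg_gen_sqrt_inv
                  (fun y => diag_entries lm1 y \/ diag_entries lp1 y)
                  (entries B0) x
                <-> Uqgl_alg lm1 lp1 x,
      forall x, alg_gen_sqrt_inv
                  (fun y => diag_entries lm2 y \/ diag_entries lp2 y)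
                  (entries Binf) x
                <-> Uqgl_alg lm2 lp2 x
    & forall x k,
        alg_gen (fun y => Uqgl_alg lm1 lp1 y \/ Uqgl_alg lm2 lp2 y) x ->
        GRing.comm x (b k)].

End Algebra.

(* Main.v *)
Require Import Defs.
From mathcomp Require Import all_boot all_order all_algebra.
From mathcomp Require Import mxtens boolp classical_sets.
From mathcomp Require Import ring zify.

Set Implicit Arguments.
Unset Strict Implicit.
Unset Printing Implicit Defensive.

Import Order.TTheory GRing.Theory Num.Theory.
Local Open Scope ring_scope.

(** In the limits w -> 0 and w -> oo the defining relations become
    R T_1(z) l_2 = l_2 T_1(z) R, where R is the coefficient of z or of z^-1 in
    R_12(z), T is either of T^+ and T^-, and l is either l^- or l^+. As l and R are
    triangular, such a relation survives the restriction of the second space to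
    the first m or to the last p basis vectors; there R also commutes with K_1,
    which is scalar on the block. Hence, with B = T^+ K (T^-)^-1,
      l_2 B_1(z) = R B_1(z) R^-1 l_2.
    Taking the trace over the first space against M removes R, because
    tr_1 (M_1 R X_1 R^-1) = tr (M X) for every X, and what is left says that the
    entries of l in the block commute with b(z). Up to a scalar, B(0) and Bhat(oo)
    are the products l^- (l^+)^-1 of the last block and l^+ (l^-)^-1 of the first
    one, and the factors are recovered from these products by a triangular
    decomposition. The commutation of l itself (and not just of l^2) with b(z) is
    what makes the square roots harmless. *)

(** * Series and triangular matrices *)

(** Course-of-values recursion: the hypothesis says that [step k] reads only the values up to [k].
    Row [g k] of the table built below is correct up to index [k], and the diagonal of the table is
    the solution. *)
Lemma nat_rec_prefix (T : Type) (c : T) (step : nat -> (nat -> T) -> T) :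
  (forall k f g, (forall j, (j <= k)%N -> f j = g j) -> step k f = step k g) ->
  exists2 Y : nat -> T, Y 0%N = c & forall k, Y k.+1 = step k Y.
Proof.
move=> step_ext.
pose g := fix g k : nat -> T := if k is k'.+1 then
  fun j => if (j <= k')%N then g k' j else step k' (g k') else fun=> c.
have gE k j : (j <= k)%N -> g k j = g j j.
  elim: k => [|k IH]; first by rewrite leqn0 => /eqP->.
  by rewrite leq_eqVlt => /orP[/eqP->//|]; rewrite ltnS => jk /=; rewrite jk IH.
exists (fun k => g k k) => // k /=; rewrite ltnn.
by apply: step_ext => j jk; apply: gE.
Qed.

Section Series.
Variables (F : fieldType) (A : algType F) (n : nat).
Implicit Types X Y Z : nat -> 'M[A]_n.
Local Notation smon := (@smon F A n).

Lemma smul_rev X Y k : smul X Y k = \sum_(i < k.+1) X (k - i)%N *m Y i.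
Proof.
rewrite /smul (reindex_inj rev_ord_inj) /=; apply: eq_bigr => i _.
by rewrite subSS subKn ?leq_ord.
Qed.

Lemma smulA X Y Z : smul X (smul Y Z) = smul (smul X Y) Z.
Proof.
apply/funext => k; rewrite [RHS]smul_rev {1}/smul.
pose c3 j l := X j *m (Y (k - j - l)%N *m Z l).
transitivity (\sum_(j < k.+1) \sum_(l < k.+1 | (l <= k - j)%N) c3 j l).
  apply: eq_bigr => /= j _; rewrite smul_rev mulmx_sumr.
  by rewrite (big_ord_narrow_leq (leq_subr _ _)).
rewrite (exchange_big_dep predT) //=; apply: eq_bigr => l _.
transitivity (\sum_(j < k.+1 | (j <= k - l)%N) c3 j l).
  apply: eq_bigl => j; rewrite -ltnS -(ltnS j) -!subSn ?leq_ord //.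
  by rewrite -subn_gt0 -(subn_gt0 j) -!subnDA addnC.
rewrite (big_ord_narrow_leq (leq_subr _ _)) /smul mulmx_suml.
by apply: eq_bigr => j _; rewrite /c3 -!subnDA addnC mulmxA.
Qed.

Lemma smul_mon d X k : smul X (smon d) k = if (d <= k)%N then X (k - d)%N else 0.
Proof.
rewrite smul_rev; case: leqP => dk.
  rewrite (bigD1 (Ordinal (dk : (d < k.+1)%N))) //= /smon eqxx mulmx1.
  rewrite big1 ?addr0 // => i /eqP ne; case: eqP => [id|_]; last first.
    by rewrite (_ : 0%:M = 0) ?mulmx0 // raddf0.
  by case: ne; apply: val_inj.
rewrite big1 // => i _; rewrite /smon ltn_eqF; last by apply: leq_trans dk.
by rewrite (_ : 0%:M = 0) ?mulmx0 // raddf0.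
Qed.

Lemma mon_smul d X k : smul (smon d) X k = if (d <= k)%N then X (k - d)%N else 0.
Proof.
rewrite /smul; case: leqP => dk.
  rewrite (bigD1 (Ordinal (dk : (d < k.+1)%N))) //= /smon eqxx mul1mx.
  rewrite big1 ?addr0 // => i /eqP ne; case: eqP => [id|_]; last first.
    by rewrite (_ : 0%:M = 0) ?mul0mx // raddf0.
  by case: ne; apply: val_inj.
rewrite big1 // => i _; rewrite /smon ltn_eqF; last by apply: leq_trans dk.
by rewrite (_ : 0%:M = 0) ?mul0mx // raddf0.
Qed.

Lemma smul_monC d X : smul X (smon d) = smul (smon d) X.
Proof. by apply/funext => k; rewrite smul_mon mon_smul. Qed.

Lemma mon0_smul X : smul (smon 0) X = X.
Proof. by apply/funext => k; rewrite mon_smul subn0. Qed.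

Lemma smul_mon0 X : smul X (smon 0) = X.
Proof. by rewrite smul_monC mon0_smul. Qed.

Lemma smon_inj d X Y : smul (smon d) X = smul (smon d) Y -> X = Y.
Proof.
move=> eqXY; apply/funext => k; move/(congr1 (fun f => f (d + k)%N)): eqXY.
by rewrite !mon_smul leq_addr addKn.
Qed.

Lemma smul0 X Y : smul X Y 0%N = X 0%N *m Y 0%N.
Proof. by rewrite /smul big_ord_recl big_ord0 addr0. Qed.

(** The equation X Y = 1 can be solved one coefficient at a time: the coefficient of u^(k+1)
    expresses X_0 Y_(k+1) through earlier terms, and [C] solves for the new one. *)
Lemma smul_unitr X C : X 0%N *m C = 1%:M ->
  exists2 Y, Y 0%N = C & smul X Y = smon 0.
Proof.
move=> XC.
have [|Y Y0 YS] := @nat_rec_prefix 'M[A]_n C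
  (fun k Y => - (C *m \sum_(i < k.+1) X i.+1 *m Y (k - i)%N)).
  move=> k f g fg; congr (- (C *m _)); apply: eq_bigr => i _.
  by rewrite fg // leq_subr.
exists Y => //; apply/funext => -[|k]; first by rewrite smul0 Y0 XC.
rewrite /smul big_ord_recl /= YS mulmxN mulmxA XC mul1mx.
have -> : smon 0 k.+1 = 0 by rewrite /smon raddf0.
apply/eqP; rewrite addrC subr_eq0.
by apply/eqP/eq_bigr => i _; rewrite /bump /= add1n subSS.
Qed.

(** The right inverse Y has an invertible constant term too, hence a right inverse Z of its own, and
    X = X Y Z = Z. *)
Lemma smul_unit X C : X 0%N *m C = 1%:M -> C *m X 0%N = 1%:M ->
  exists Y, [/\ Y 0%N = C, smul X Y = smon 0 & smul Y X = smon 0].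
Proof.
move=> XC CX; have [Y Y0 XY] := smul_unitr XC; exists Y; split=> //.
have [|Z _ YZ] := @smul_unitr Y (X 0%N); first by rewrite Y0.
suff -> : X = Z by [].
by rewrite -[Z]mon0_smul -XY -smulA YZ smul_mon0.
Qed.

(** If Z is another solution, u^d Z = Y X Z = Y u^d = u^d Y, and u^d can be cancelled because it
    only shifts coefficients. *)
Lemma sinv_eq d X Y : smul X Y = smon d -> smul Y X = smon d -> sinv d X = Y.
Proof.
move=> XY YX; rewrite /sinv; apply: xget_unique; first by split=> k; rewrite ?XY ?YX.
move=> Z /= [/funext XZ _]; apply: (@smon_inj d).
by rewrite -{1}YX -smulA XZ smul_monC.
Qed.

End Series.

(** * Closure properties of subalgebras and of matrices with entries in them *)

Section Subalgebra.
Variables (F : fieldType) (A : algType F).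
Variable S : A -> Prop.
Hypothesis algS : subalg S.

Lemma subalgD x y : S x -> S y -> S (x + y). Proof. by case: algS => _ + _; apply. Qed.
Lemma subalgM x y : S x -> S y -> S (x * y). Proof. by case: algS => _ _; apply. Qed.
Lemma subalg_scalar c : S c%:A. Proof. by case: algS. Qed.
Lemma subalg0 : S 0. Proof. by rewrite -(scale0r 1); apply: subalg_scalar. Qed.
Lemma subalg1 : S 1. Proof. by rewrite -(scale1r 1); apply: subalg_scalar. Qed.
Lemma subalgZ c x : S x -> S (c *: x).
Proof. by move=> Sx; rewrite -mulr_algl; apply/subalgM/Sx/subalg_scalar. Qed.
Lemma subalgB x y : S x -> S y -> S (x - y).
Proof. by move=> Sx Sy; rewrite -scaleN1r; apply/subalgD/subalgZ. Qed.
Lemma subalg_sum (I : finType) (P : pred I) (f : I -> A) :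
  (forall i, P i -> S (f i)) -> S (\sum_(i | P i) f i).
Proof. by move=> Sf; apply: big_ind => //; [apply: subalg0|apply: subalgD]. Qed.

Definition mx_in (r c : nat) (X : 'M[A]_(r, c)) := forall i j, S (X i j).

Lemma mx_inM r c t (X : 'M_(r, c)) (Y : 'M_(c, t)) :
  mx_in X -> mx_in Y -> mx_in (X *m Y).
Proof.
by move=> SX SY i j; rewrite mxE; apply: subalg_sum => k _; apply: subalgM.
Qed.

Lemma mx_in1 n : mx_in (1%:M : 'M_n).
Proof.
by move=> i j; rewrite mxE; case: (_ == _); [apply: subalg1|apply: subalg0].
Qed.

End Subalgebra.

(** * Triangular matrices over a noncommutative algebra *)

Section Triangular.
Variables (F : fieldType) (A : algType F) (n : nat) (rho : 'I_n -> nat).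
Hypothesis rho_inj : injective rho.
Implicit Types X Y : 'M[A]_n.

(** The rank function lets one theory serve both shapes: [val] gives lower triangular matrices, and
    the reversed rank [revrank] upper triangular ones. *)
Definition triangular X := forall i j, (rho i < rho j)%N -> X i j = 0.

Lemma triangularM X Y : triangular X -> triangular Y -> triangular (X *m Y).
Proof.
move=> tX tY i j ij; rewrite mxE big1 // => k _.
have [ik|ki] := ltnP (rho i) (rho k); first by rewrite tX ?mul0r.
by rewrite tY ?mulr0 // (leq_ltn_trans ki).
Qed.

Lemma triangularM_diag X Y i : triangular X -> triangular Y ->
  (X *m Y) i i = X i i * Y i i.
Proof.
move=> tX tY; rewrite mxE (bigD1 i) //= big1 ?addr0 // => k ki.
have [ik|/ltnW|/rho_inj eki] := ltngtP (rho i) (rho k).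
- by rewrite tX ?mul0r.
- rewrite leq_eqVlt => /orP[/eqP/rho_inj eki|]; first by rewrite eki eqxx in ki.
  by move=> /tY->; rewrite mulr0.
- by rewrite eki eqxx in ki.
Qed.

Lemma triangular1 : triangular 1%:M.
Proof.
by move=> i j ij; rewrite mxE; case: eqP => // e; rewrite e ltnn in ij.
Qed.

(** Each factor X lowers the rank by at least one, so an entry (i, j) of X^k can be nonzero only if
    [rho j + k <= rho i]. *)
Lemma strict_nilpotent X :
  (forall i j, (rho i <= rho j)%N -> X i j = 0) ->
  X ^+ (\max_i rho i).+1 = 0.
Proof.
move=> sX.
have XkE k i j : (rho i < rho j + k)%N -> (X ^+ k) i j = 0.
  elim: k i j => [|k IH] i j.
    by rewrite addn0 expr0; apply: triangular1.
  rewrite exprS mxE => ij; rewrite big1 // => l _.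
  have [il|li] := leqP (rho i) (rho l); first by rewrite sX ?mul0r.
  by rewrite IH ?mulr0 // -ltnS -addnS (leq_trans _ ij).
apply/matrixP => i j; rewrite XkE ?mxE // ltn_addl // ltnS.
exact: (leq_bigmax i).
Qed.

(** With D the diagonal matrix of the [d i], the matrix N = 1 - D X is nilpotent, so D X is inverted
    by the finite geometric series G in N, and Y = G D. The entries of Y are thus polynomials in
    those of X and the [d i], which gives the last clause. *)
Lemma triangular_inv X (d : 'I_n -> A) : triangular X ->
  (forall i, X i i * d i = 1) -> (forall i, d i * X i i = 1) ->
  exists Y, [/\ X *m Y = 1%:M, Y *m X = 1%:M, triangular Y,
     forall i, Y i i = d i
   & forall S, subalg S -> mx_in S X -> (forall i, S (d i)) -> mx_in S Y].
Proof.
move=> tX Xd dX; pose D := diag_mx (\row_i d i).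
pose D' := diag_mx (\row_i X i i).
have DX : D *m D' = 1%:M.
  apply/matrixP => i j; rewrite mul_diag_mx !mxE.
  by case: eqP => _; rewrite ?mulr1n ?dX ?mulr0.
have XD : D' *m D = 1%:M.
  apply/matrixP => i j; rewrite mul_diag_mx !mxE.
  by case: eqP => _; rewrite ?mulr1n ?Xd ?mulr0.
pose N := 1%:M - D *m X.
have sN i j : (rho i <= rho j)%N -> N i j = 0.
  rewrite /N mul_diag_mx !mxE leq_eqVlt => /orP[/eqP/rho_inj<-|ij].
    by rewrite eqxx dX subrr.
  rewrite tX // mulr0; case: eqP => [e|_]; last by rewrite subr0.
  by rewrite e ltnn in ij.
pose b := (\max_i rho i).+1; pose G := \sum_(i < b) N ^+ i.
have NE : D *m X = - (N - 1) :> 'M_n.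
  by rewrite opprB; apply/eqP; rewrite eq_sym subr_eq addrC subrK.
have XG : (D *m X) *m G = 1%:M.
  apply: (@etrans _ _ (- (N ^+ b - 1))); last first.
    by rewrite strict_nilpotent // sub0r opprK.
  by rewrite subrX1 -mulNr NE.
have GX : G *m (D *m X) = 1%:M.
  rewrite -[RHS]XG NE; suff: GRing.comm G (- (N - 1)) by [].
  apply/commr_sym/commr_sum => i _; apply/commrX/commr_sym/commrN/commrB => //.
  exact: commr1.
have tD : triangular D.
  by move=> i j ij; rewrite !mxE; case: eqP => // e; rewrite e ltnn in ij.
have tN : triangular N by move=> i j /ltnW; apply: sN.
have tG : triangular G.
  move=> i j ij; rewrite /G summxE big1 // => k _.
  have tNk : triangular (N ^+ k); last exact: tNk.
  by elim: (k : nat) => [|l IH]; [apply: triangular1|rewrite exprS; apply: triangularM].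
have YX : (G *m D) *m X = 1%:M by rewrite -mulmxA.
have tY : triangular (G *m D) by apply: triangularM.
exists (G *m D); split=> //.
- by rewrite mulmxA -[X *m G]mul1mx -XD -(mulmxA D') (mulmxA D X) XG mulmx1.
- move=> i; have := triangularM_diag i tY tX; rewrite YX mxE eqxx => e.
  by rewrite -[LHS]mulr1 -(Xd i) mulrA -e mul1r.
move=> S aS SX Sd; have SD : mx_in S D.
  by move=> i j; rewrite !mxE; case: (_ == _); rewrite ?mulr1n ?mulr0n //; apply: subalg0.
apply: mx_inM => // i j; rewrite /G summxE; apply: subalg_sum => // k _.
elim: (k : nat) i j => [|l IH]; first by rewrite expr0; apply: mx_in1.
rewrite exprS; apply: mx_inM => // i j; rewrite /N [X in S X]mxE.
rewrite [X in S (_ + X)]mxE; apply: subalgB => //; first exact: mx_in1.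
exact: mx_inM.
Qed.

(* The factors are read off the product by induction on [rho]: the [t]-th
   diagonal entry of the product is [g t ^+ 2] up to lower terms. *)
Lemma mx_in_lu (S : A -> Prop) X Y (g g' : 'I_n -> A) : subalg S ->
  triangular X -> (forall i j, (rho j < rho i)%N -> Y i j = 0) ->
  (forall i, X i i = g i) -> (forall i, Y i i = g i) ->
  (forall i, g i * g' i = 1) -> (forall i, g' i * g i = 1) ->
  (forall i, S (g i ^+ 2) -> S (g i)) -> (forall i, S (g i) -> S (g' i)) ->
  mx_in S (X *m Y) -> mx_in S X /\ mx_in S Y.
Proof.
move=> aS tX tY Xg Yg gg' g'g Sg2 Sg' SXY.
suff H t h : rho h = t ->
    [/\ S (g h), forall i, S (X i h) & forall j, S (Y h j)].
  split=> i j; first by have [] := H _ j erefl.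
  by have [] := H _ i erefl.
elim/ltn_ind: t h => t IH h ht.
pose rest i j := \sum_(k | (rho k < t)%N) X i k * Y k j.
have Srest i j : S (rest i j).
  by apply: subalg_sum => // k /IH /(_ k erefl) [_ SX SY]; apply: subalgM.
(* Indices of rank above t drop out by triangularity, those of rank below t make up [rest], and [h]
   is the only one of rank t. *)
have XYE i j : (rho i = t \/ rho j = t) ->
    (X *m Y) i j - rest i j = X i h * Y h j.
  move=> ijt; rewrite mxE (bigID (fun k => rho k < t)%N) /= -/(rest i j).
  rewrite addrAC subrr add0r (bigD1 h) /= ?ht ?ltnn // big1 ?addr0 // => k.
  rewrite -leqNgt leq_eqVlt => /andP[/orP[/eqP e|tk] kh].
    by move: kh; rewrite (rho_inj (etrans (esym e) (esym ht))) eqxx.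
  by case: ijt => e; [rewrite tX ?mul0r|rewrite tY ?mulr0]; rewrite ?e.
have Sg : S (g h).
  apply: Sg2; rewrite expr2 -{1}(Xg h) -(Yg h) -XYE; last by left.
  exact: subalgB.
split=> // [i|j].
  suff -> : X i h = ((X *m Y) i h - rest i h) * g' h.
    by apply: subalgM => //; [apply: subalgB|apply: Sg'].
  by rewrite XYE; [rewrite Yg -mulrA gg' mulr1|right].
suff -> : Y h j = g' h * ((X *m Y) h j - rest h j).
  by apply: subalgM => //; [apply: Sg'|apply: subalgB].
by rewrite XYE; [rewrite Xg mulrA g'g mul1r|left].
Qed.

End Triangular.

(** * The R-matrix *)

Section RMatrix.
Variables (F : fieldType) (q : F).

(** [Rdiag e i k] and [Roff e i k] are the coefficients of E_ii (x) E_kk and of E_ik (x) E_ki in the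
    degree e part of R. The indices are natural numbers, so that spaces of different dimensions
    share them. *)
Definition Rdiag (e : int) (i k : nat) : F := if i == k then acoef q e else bcoef F e.
Definition Rflip (e : int) (i k : nat) : bool :=
  (i != k) && (e == Num.sg (k%:Z - i%:Z)).
Definition Roff (e : int) (i k : nat) : F := (q - q^-1) *+ Rflip e i k.

Lemma RdiagC e i k : Rdiag e i k = Rdiag e k i.
Proof. by rewrite /Rdiag eq_sym. Qed.

Lemma Rflip1 i k : Rflip 1 i k = (i < k)%N.
Proof.
rewrite /Rflip; case: (ltngtP i k) => [ik|ki|->] //=.
  by rewrite gtr0_sg ?subr_gt0 ?ltz_nat.
by rewrite ltr0_sg ?subr_lt0 ?ltz_nat.
Qed.

Lemma RflipN1 i k : Rflip (-1) i k = (k < i)%N.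
Proof.
rewrite /Rflip; case: (ltngtP i k) => [ik|ki|->] //=.
  by rewrite eq_sym gtr0_sg ?subr_gt0 ?ltz_nat.
by rewrite ltr0_sg ?subr_lt0 ?ltz_nat.
Qed.

Lemma RflipN e i k : Rflip (- e) i k = Rflip e k i.
Proof. by rewrite /Rflip eq_sym -[in RHS]opprB sgrN eqr_oppLR. Qed.

Lemma Rflip_asym e i k : Rflip e i k -> Rflip e k i = false.
Proof.
rewrite /Rflip => /andP[ik /eqP->]; rewrite eq_sym ik /=.
case: (ltngtP i k) ik => // h _.
  by rewrite gtr0_sg ?ltr0_sg ?subr_gt0 ?subr_lt0 ?ltz_nat.
by rewrite ltr0_sg ?gtr0_sg ?subr_gt0 ?subr_lt0 ?ltz_nat.
Qed.

Lemma sum_tens_index (V : nmodType) n (f : 'I_(n * n) -> V) :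
  \sum_x f x = \sum_i \sum_k f (mxtens_index (i, k)).
Proof.
rewrite pair_bigA /= (reindex (@mxtens_index n n)) /=.
  by apply: eq_bigr => -[].
by exists (@mxtens_unindex n n) => x _; rewrite (mxtens_indexK, mxtens_unindexK).
Qed.

Lemma RcoefE n e (i k a h : 'I_n) :
  Rcoef q n e (mxtens_index (i, k)) (mxtens_index (a, h)) =
  Rdiag e i k *+ ((i == a) && (k == h)) + Roff e i k *+ ((i == h) && (k == a)).
Proof.
rewrite /Rcoef !mxE !summxE.
have -> : \sum_(c < n) (delta_mx c c *t delta_mx c c)
    (mxtens_index (i, k)) (mxtens_index (a, h)) =
    [&& i == k, i == a & k == h]%:R :> F.
  under eq_bigr => c _ do rewrite tensmxE !mxE.
  rewrite (bigD1 i) //= big1 ?addr0 => [|c ci].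
    rewrite eqxx /= -natrM mulnb; congr (nat_of_bool _)%:R.
    rewrite (eq_sym k); have [<-|_] := eqVneq i k; last by rewrite andbF.
    by rewrite (eq_sym a) (eq_sym h).
  by rewrite eq_sym (negPf ci) mul0r.
have -> : \sum_(c < n) (\sum_(b < n | c != b) delta_mx c c *t delta_mx b b)
    (mxtens_index (i, k)) (mxtens_index (a, h)) =
    [&& i != k, i == a & k == h]%:R :> F.
  rewrite (bigD1 i) //= [X in _ + X]big1 ?addr0 => [|c ci]; last first.
    by rewrite summxE big1 // => b _; rewrite tensmxE !mxE eq_sym (negPf ci) mul0r.
  rewrite summxE; have [<-{k}|ik] /= := eqVneq i k.
    by rewrite big1 // => b ib; rewrite tensmxE !mxE (negPf ib) mulr0.
  rewrite (bigD1 k) //= big1 ?addr0 => [|b /andP[_ bk]]; rewrite tensmxE !mxE.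
    by rewrite !eqxx -natrM mulnb /= ![_ == i]eq_sym ![_ == k]eq_sym.
  by rewrite (eq_sym k) (negPf bk) mulr0.
have -> : \sum_(c < n) (\sum_(b < n | c != b)
    (e == Num.sg (b%:Z - c%:Z))%:R *: (delta_mx c b *t delta_mx b c))
    (mxtens_index (i, k)) (mxtens_index (a, h)) =
    (Rflip e i k && ((i == h) && (k == a)))%:R :> F.
  rewrite (bigD1 i) //= [X in _ + X]big1 ?addr0 => [|c ci]; last first.
    by rewrite summxE big1 // => b _; rewrite mxE tensmxE !mxE (eq_sym i) (negPf ci) mul0r mulr0.
  rewrite summxE /Rflip; have [<-{k}|ik] /= := eqVneq i k.
    by rewrite eqxx big1 // => b ib; rewrite mxE tensmxE !mxE (negPf ib) /= !mulr0.
  rewrite (bigD1 k) //= big1 ?addr0 => [|b /andP[_ bk]]; rewrite mxE tensmxE !mxE.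
    rewrite !eqxx -!natrM !mulnb /= (inj_eq val_inj) ik.
    by rewrite (eq_sym a) (eq_sym h) [(k == a) && _]andbC.
  by rewrite (eq_sym k) (negPf bk) /= ?mul0r !mulr0.
rewrite /Rdiag /Roff (inj_eq val_inj).
have -> : (q - q^-1) * (Rflip e i k && ((i == h) && (k == a)))%:R =
    (q - q^-1) *+ Rflip e i k *+ ((i == h) && (k == a)).
  by rewrite mulr_natr -mulnb mulrnA.
congr (_ + _); case: (i == k) => /=; rewrite !mulr_natr ?mulr0n ?addr0 ?add0r //.
Qed.

End RMatrix.

(** * Exchange relations written out in entries *)

Section RLL.
Variables (F : fieldType) (A : algType F) (q : F).

Lemma sum_delta2 (V : nmodType) n (f : 'I_n -> 'I_n -> V) u v :
  \sum_i \sum_k f i k *+ ((u == i) && (v == k)) = f u v.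
Proof.
rewrite (bigD1 u) //= [X in _ + X]big1 ?addr0 => [|i iu]; last first.
  by rewrite big1 // => k _; rewrite eq_sym (negPf iu).
rewrite (bigD1 v) //= big1 ?addr0 ?eqxx // => k kv.
by rewrite (eq_sym v) (negPf kv).
Qed.

Lemma scalmxM r c t (X : 'M[F]_(r, c)) (Y : 'M_(c, t)) :
  scalmx A (X *m Y) = scalmx A X *m scalmx A Y.
Proof. exact: map_mxM. Qed.

Lemma scalmx1 n : scalmx A (1%:M : 'M_n) = 1%:M.
Proof. exact: map_mx1. Qed.

Lemma scalmxE r c (X : 'M[F]_(r, c)) i j : scalmx A X i j = (X i j)%:A.
Proof. by rewrite mxE. Qed.

Lemma mul_inj1E n (M : 'M[A]_(n * n)) (X : 'M[A]_n) x j h :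
  (M *m inj1 X) x (mxtens_index (j, h)) = \sum_a M x (mxtens_index (a, h)) * X a j.
Proof.
rewrite mxE sum_tens_index; apply: eq_bigr => a _.
rewrite (bigD1 h) //= big1 ?addr0 => [|g gh]; rewrite /inj1 tensmxE mxE.
  by rewrite eqxx mulr1.
by rewrite (negPf gh) !mulr0.
Qed.

Lemma mul_inj2E n (M : 'M[A]_(n * n)) (Y : 'M[A]_n) x j h :
  (M *m inj2 Y) x (mxtens_index (j, h)) = \sum_g M x (mxtens_index (j, g)) * Y g h.
Proof.
rewrite mxE sum_tens_index exchange_big /=; apply: eq_bigr => g _.
rewrite (bigD1 j) //= big1 ?addr0 => [|a aj]; rewrite /inj2 tensmxE mxE.
  by rewrite eqxx mul1r.
by rewrite (negPf aj) mul0r !mulr0.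
Qed.

Lemma inj2E n (Y : 'M[A]_n) i k j h :
  inj2 Y (mxtens_index (i, k)) (mxtens_index (j, h)) = Y k h *+ (i == j).
Proof. by rewrite /inj2 tensmxE mxE mulr_natl. Qed.

(** Each row and each column of R has at most two nonzero entries, so the double sums in both
    products collapse to two terms each. *)
Lemma RLL0E n e (X Y : 'M[A]_n) :
  RLL0 (Rcoef q n e) X Y <-> forall i k j h : 'I_n,
    Rdiag q e i k *: (X i j * Y k h) + Roff q e i k *: (X k j * Y i h) =
    Rdiag q e j h *: (Y k h * X i j) + Roff q e h j *: (Y k j * X i h).
Proof.
pose lhs := scalmx A (Rcoef q n e) *m inj1 X *m inj2 Y.
pose rhs := inj2 Y *m inj1 X *m scalmx A (Rcoef q n e).
have lhsE i k j h : lhs (mxtens_index (i, k)) (mxtens_index (j, h)) =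
    Rdiag q e i k *: (X i j * Y k h) + Roff q e i k *: (X k j * Y i h).
  rewrite /lhs mul_inj2E; under eq_bigr => g _ do rewrite mul_inj1E mulr_suml.
  under eq_bigr => g _ do under eq_bigr => a _ do
    rewrite mxE RcoefE -mulrA mulr_algl scalerDl -!scalerMnl.
  under eq_bigr => g _ do rewrite big_split /=.
  rewrite big_split /=; congr (_ + _).
    rewrite exchange_big -[RHS](sum_delta2 (fun a g => Rdiag q e i k *: (X a j * Y g h))) /=.
    by apply: eq_bigr => a _; apply: eq_bigr => g _; rewrite scalerMnl.
  rewrite -[RHS](sum_delta2 (fun g a => Roff q e i k *: (X a j * Y g h))) /=.
  by apply: eq_bigr => a _; apply: eq_bigr => g _; rewrite scalerMnl.
have rhsE i k j h : rhs (mxtens_index (i, k)) (mxtens_index (j, h)) =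
    Rdiag q e j h *: (Y k h * X i j) + Roff q e h j *: (Y k j * X i h).
  rewrite /rhs mxE sum_tens_index.
  transitivity (\sum_a \sum_g (
      (Rdiag q e j h *: (Y k g * X i a)) *+ ((j == a) && (h == g)) +
      (Roff q e h j *: (Y k g * X i a)) *+ ((h == a) && (j == g)))).
    apply: eq_bigr => a _; apply: eq_bigr => g _.
    rewrite mul_inj1E (bigD1 i) //= big1 ?addr0 => [|b bi]; last first.
      by rewrite inj2E eq_sym (negPf bi) mulr0n mul0r.
    rewrite inj2E eqxx mulr1n mxE RcoefE mulr_algr scalerDl -!scalerMnl.
    rewrite (eq_sym a j) (eq_sym g h) (eq_sym a h) (eq_sym g j).
    congr (_ + _).
      by have [->|_] := eqVneq j a; have [->|_] := eqVneq h g.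
    by have [->|_] := eqVneq h a; have [->|_] := eqVneq j g.
  under eq_bigr do rewrite big_split /=.
  by rewrite big_split /= !sum_delta2.
split=> [eqR i k j h|eqE]; first by rewrite -lhsE -rhsE /lhs eqR.
rewrite /RLL0 -/lhs -/rhs; apply/matrixP => x y.
case: (mxtens_indexP x) => i k; case: (mxtens_indexP y) => j h.
by rewrite lhsE rhsE eqE.
Qed.

Hypothesis q0 : q != 0.

Lemma acoefN e : e = 1 \/ e = -1 -> acoef q e * acoef q (- e) = -1.
Proof. by case=> ->; rewrite /acoef /= ?opprK /= ?subr0 ?sub0r ?mulrN ?mulNr ?mulfV ?mulVf. Qed.

Lemma bcoefN e : bcoef F (- e) = - bcoef F e.
Proof. by rewrite /bcoef eqr_oppLR eqr_opp opprB. Qed.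

Lemma bcoef_sq e : e = 1 \/ e = -1 -> bcoef F e * bcoef F e = 1.
Proof. by case=> ->; rewrite /bcoef /= ?subr0 ?sub0r ?mulrN ?mulNr ?opprK mulr1. Qed.

Lemma Rcoef_eq0 n e : e <> 1 -> e <> -1 -> Rcoef q n e = 0.
Proof.
move=> /eqP/negPf e1 /eqP/negPf eN1; apply/matrixP => x y.
case: (mxtens_indexP x) => i k; case: (mxtens_indexP y) => j h.
rewrite RcoefE mxE /Rdiag /Roff /acoef /bcoef e1 eN1 !subr0 if_same mul0rn add0r.
rewrite /Rflip; case: (ltngtP i k) => [ik|ki|_] /=; last by rewrite !mul0rn.
  by rewrite gtr0_sg ?subr_gt0 ?ltz_nat // e1 mul0rn.
by rewrite ltr0_sg ?subr_lt0 ?ltz_nat // eN1 mul0rn.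
Qed.

End RLL.

(** * Exchange of the two tensor factors, and unitarity of R *)

Section Swap.
Variable n : nat.

Definition tens_swap (x : 'I_(n * n)) : 'I_(n * n) :=
  let: (i, k) := mxtens_unindex x in mxtens_index (k, i).

Lemma tens_swapE i k : tens_swap (mxtens_index (i, k)) = mxtens_index (k, i).
Proof. by rewrite /tens_swap mxtens_indexK. Qed.

Lemma tens_swapK : involutive tens_swap.
Proof. by move=> x; case: (mxtens_indexP x) => i k; rewrite !tens_swapE. Qed.

Definition mxswap (V : Type) (M : 'M[V]_(n * n)) : 'M[V]_(n * n) :=
  \matrix_(x, y) M (tens_swap x) (tens_swap y).

Lemma mxswapK V : involutive (@mxswap V).
Proof. by move=> M; apply/matrixP => x y; rewrite !mxE !tens_swapK. Qed.

Lemma mxswapM (V : pzSemiRingType) (M N : 'M[V]_(n * n)) :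
  mxswap (M *m N) = mxswap M *m mxswap N.
Proof.
apply/matrixP => x y; rewrite !mxE (reindex_inj (inv_inj tens_swapK)) /=.
by apply: eq_bigr => z _; rewrite !mxE.
Qed.

Lemma mxswap_inj1 (F : fieldType) (A : algType F) (X : 'M[A]_n) :
  mxswap (inj1 X) = inj2 X.
Proof.
apply/matrixP => x y; case: (mxtens_indexP x) => i k.
case: (mxtens_indexP y) => j h; rewrite mxE !tens_swapE /inj1 /inj2 !tensmxE !mxE.
by rewrite mulr_natr mulr_natl.
Qed.

Lemma mxswap_inj2 (F : fieldType) (A : algType F) (X : 'M[A]_n) :
  mxswap (inj2 X) = inj1 X.
Proof. by rewrite -mxswap_inj1 mxswapK. Qed.

End Swap.

Section RLLSym.
Variables (F : fieldType) (A : algType F) (q : F).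
Hypothesis q0 : q != 0.

Lemma mxswap_scalmx n (M : 'M[F]_(n * n)) : mxswap (scalmx A M) = scalmx A (mxswap M).
Proof. by apply/matrixP => x y; rewrite !mxE. Qed.

(** The diagonal coefficients multiply to -1; two flips never compose, since a given degree allows a
    pair of indices to be flipped in one direction only; the two mixed terms cancel because [bcoef]
    is odd in the degree. *)
Lemma mul_Rcoef_swap n e : e = 1 \/ e = -1 ->
  Rcoef q n e *m mxswap (Rcoef q n (- e)) = - 1%:M.
Proof.
move=> he; apply/matrixP => x y; case: (mxtens_indexP x) => i k.
case: (mxtens_indexP y) => j h; rewrite mxE sum_tens_index.
transitivity (Rdiag q e i k * Rcoef q n (- e) (mxtens_index (k, i)) (mxtens_index (h, j))
  + Roff q e i k * Rcoef q n (- e) (mxtens_index (i, k)) (mxtens_index (h, j))).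
  rewrite -(sum_delta2 (fun a g => Rdiag q e i k * Rcoef q n (- e)
     (mxtens_index (g, a)) (mxtens_index (h, j)))).
  rewrite -(sum_delta2 (fun a g => Roff q e i k * Rcoef q n (- e)
     (mxtens_index (g, a)) (mxtens_index (h, j))) k i) -big_split /=.
  apply: eq_bigr => a _; rewrite -big_split; apply: eq_bigr => g _ /=.
  by rewrite RcoefE mxE !tens_swapE mulrDl !mulrnAl [(k == a) && _]andbC.
rewrite !RcoefE !mxE (can_eq (@mxtens_indexK n n)) xpair_eqE.
rewrite (RdiagC q (- e) k i) [(k == h) && _]andbC [(k == j) && _]andbC.
have : Rdiag q e i k * Rdiag q (- e) i k = -1.
  rewrite /Rdiag; case: eqP => _; first exact: acoefN.
  by rewrite bcoefN mulrN bcoef_sq.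
have : Roff q e i k * Roff q (- e) i k = 0.
  rewrite /Roff RflipN; case E: (Rflip e i k); rewrite ?mulr0n ?mul0r //.
  by rewrite Rflip_asym ?E // mulr0n mulr0.
have : Roff q e i k * Rdiag q (- e) i k = - (Rdiag q e i k * Roff q (- e) k i).
  rewrite /Roff RflipN /Rdiag bcoefN; case: eqP => [->|_]; last by rewrite mulrN mulrC.
  by rewrite /Rflip eqxx mulr0n mul0r mulr0 oppr0.
move: (Rdiag q e i k) (Rdiag q (- e) i k) (Roff q e i k) (Roff q (- e) i k).
move: (Roff q (- e) k i) => o' d d' o o'' H1 H2 H3.
rewrite !mulrDr !mulrnAr H1 H2 H3 mul0rn addr0 -addrA !mulNrn addrN addr0 //.
Qed.

Lemma mul_swap_Rcoef n e : e = 1 \/ e = -1 ->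
  mxswap (Rcoef q n (- e)) *m Rcoef q n e = - 1%:M.
Proof.
move=> he; have hN : - e = 1 \/ - e = -1 by case: he => ->; rewrite ?opprK; [right|left].
rewrite -[X in _ *m X]mxswapK -mxswapM -[X in mxswap (Rcoef q n X)]opprK.
rewrite mul_Rcoef_swap // ?opprK //.
by apply/matrixP => x y; rewrite !mxE (can_eq (@tens_swapK n)).
Qed.

(* The [e]-part of R is inverted, up to sign, by the [- e]-part with the two
   spaces exchanged: this is the unitarity of R in the limit of extreme argument. *)
Lemma RLL0_sym n e (X Y : 'M[A]_n) :
  RLL0 (Rcoef q n e) X Y -> RLL0 (Rcoef q n (- e)) Y X.
Proof.
have [he|he] : (e = 1 \/ e = -1) \/ (e <> 1 /\ e <> -1).
- have [->|/eqP e1] := eqVneq e 1; first by left; left.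
  by have [->|/eqP eN1] := eqVneq e (-1); [left; right|right].
- move=> RXY; pose R := scalmx A (Rcoef q n e).
  pose Q := scalmx A (mxswap (Rcoef q n (- e))).
  have RQ : R *m Q = - 1%:M by rewrite -scalmxM mul_Rcoef_swap // /scalmx map_mxN map_mx1.
  have QR : Q *m R = - 1%:M by rewrite -scalmxM mul_swap_Rcoef // /scalmx map_mxN map_mx1.
  have eqQ : inj1 X *m inj2 Y *m Q = Q *m inj2 Y *m inj1 X.
    apply: oppr_inj; have := congr1 (fun M => Q *m M *m Q) RXY.
    rewrite -/R !mulmxA QR mulNmx mul1mx !mulNmx => ->.
    by rewrite -!mulmxA RQ !mulmxN mulmx1.
  have := congr1 (@mxswap n A) eqQ.
  by rewrite !mxswapM mxswap_inj1 mxswap_inj2 mxswap_scalmx mxswapK /RLL0 => ->.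
- case: he => e1 eN1 _; rewrite Rcoef_eq0.
  + by rewrite /RLL0 (_ : scalmx A 0 = 0) ?mul0mx ?mulmx0 //; apply: map_mx0.
  + by move=> eN; apply: eN1; rewrite -[e]opprK eN.
  + by move/oppr_inj.
Qed.

End RLLSym.

(** * Restriction to a block of the second space *)

(** The differences D_i = S_i y - x S_i satisfy D T = 0 as series, because S T = 1. If those below k
    vanish, then D_k T_0 = 0, and T_0 is cancelled by S_0. *)
Lemma inverse_intertwiner (R : pzRingType) (T S : nat -> R) (x y : R) :
  (forall k, \sum_(i < k.+1) S i * T (k - i)%N = (k == 0)%:R) ->
  T 0%N * S 0%N = 1 -> (forall k, T k * x = y * T k) ->
  forall k, S k * y = x * S k.
Proof.
move=> ST T0S0 Txy; elim/ltn_ind => k IH.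
pose D i := S i * y - x * S i.
have D0 i : (i < k)%N -> D i = 0 by move=> /IH e; rewrite /D e subrr.
suff Dk : D k = 0 by apply/eqP; rewrite -subr_eq0; apply/eqP.
have sumD : \sum_(i < k.+1) D i * T (k - i)%N = 0.
  under eq_bigr => i _ do rewrite /D mulrBl -mulrA -Txy mulrA -[x * _ * _]mulrA.
  rewrite sumrB -mulr_sumr -mulr_suml ST.
  by case: (k == 0); rewrite ?mul1r ?mulr1 ?mul0r ?mulr0 subrr.
move: sumD; rewrite big_ord_recr /= big1 => [|i _]; last by rewrite D0 ?mul0r.
rewrite add0r subnn => DT.
by rewrite -[D k]mulr1 -T0S0 mulrA DT mul0r.
Qed.

Section Block.
Variables (F : fieldType) (q : F) (n r c : nat) (f : 'I_r -> 'I_n).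
Hypothesis fE : forall k, f k = (c + k)%N :> nat.

Lemma block_inj : injective f.
Proof. by move=> k h /(congr1 val); rewrite /= !fE => /addnI /val_inj. Qed.

Lemma Rdiag_block e i k : Rdiag q e (f i) (f k) = Rdiag q e i k.
Proof. by rewrite /Rdiag !fE eqn_add2l. Qed.

Lemma Roff_block e i k : Roff q e (f i) (f k) = Roff q e i k.
Proof.
rewrite /Roff /Rflip !fE eqn_add2l !PoszD; congr (_ *+ (_ && (_ == Num.sg _))).
by rewrite opprD addrACA subrr add0r.
Qed.

(** In the form of [RLL0E], a relation with all four indices in the block involves only entries of
    the block, and its coefficients are invariant under the shift by [c]. *)
Lemma RLL0_block (A : algType F) e (X Y : 'M[A]_n) :
  RLL0 (Rcoef q n e) X Y -> RLL0 (Rcoef q r e) (mxsub f f X) (mxsub f f Y).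
Proof.
move=> /RLL0E RXY; apply/RLL0E => i k j h; rewrite !mxE.
by rewrite -!Rdiag_block -!Roff_block RXY.
Qed.

(* The (k, h) block, with respect to the second space, of the operator
   sum_ik d_ik E_ii (x) E_kk + sum_hk w_hk E_hk (x) E_kh, the second space being
   restricted to the basis vectors selected by [f]. *)
Definition rmx (d w : 'I_n -> 'I_n -> F) (k h : 'I_r) : 'M[F]_n :=
  diag_mx (\row_i d i (f k)) *+ (k == h) + w (f h) (f k) *: delta_mx (f h) (f k).

Lemma mul_diag_delta (u : 'rV[F]_n) (a b : 'I_n) :
  diag_mx u *m delta_mx a b = u 0 a *: delta_mx a b.
Proof.
apply/matrixP => i j; rewrite mul_diag_mx !mxE.
by case: eqP => [->|_] //=; rewrite !mulr0.
Qed.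

Lemma mul_delta_diag (u : 'rV[F]_n) (a b : 'I_n) :
  delta_mx a b *m diag_mx u = u 0 b *: delta_mx a b.
Proof.
apply/matrixP => i j; rewrite mul_mx_diag !mxE mulrC.
by case: (j =P b) => [->|_] //=; rewrite andbF !mulr0.
Qed.

(* The factor by which X is multiplied in tr_1 (M_1 r X_1 r'), where r' has been
   moved to the front by cyclicity. *)
Lemma sum_rmx_trace d w d' w' mu (k g : 'I_r) :
  \sum_h rmx d' w' h g *m diag_mx mu *m rmx d w k h =
  diag_mx (\row_i (d' i (f g) * mu 0 i * d i (f k))) *+ (k == g)
  + (w (f g) (f k) * d' (f g) (f g) * mu 0 (f g)
     + w' (f g) (f k) * d (f k) (f k) * mu 0 (f k)
     + \sum_h w' (f g) (f h) * w (f h) (f k) * mu 0 (f h)) *: delta_mx (f g) (f k).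
Proof.
under eq_bigr => h _ do rewrite /rmx !mulmxDl !mulmxDr.
rewrite !big_split /= -!addrA; congr (_ + _).
  rewrite (bigD1 g) //= big1 ?addr0 => [|h hg]; last first.
    by rewrite (negPf hg) mulr0n !mul0mx.
  rewrite eqxx mulr1n; case: eqP => [->|_]; last by rewrite mulr0n mulmx0.
  rewrite !mulr1n !mulmx_diag; congr diag_mx.
  by apply/rowP => i; rewrite !mxE.
rewrite !scalerDl; congr (_ + _).
  rewrite (bigD1 g) //= big1 ?addr0 => [|h hg]; last first.
    by rewrite (negPf hg) mulr0n !mul0mx.
  rewrite eqxx mulr1n -scalemxAr mulmx_diag mul_diag_delta scalerA.
  by rewrite !mxE mulrA.
congr (_ + _).
  rewrite (bigD1 k) //= big1 ?addr0 => [|h hk]; last first.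
    by rewrite eq_sym (negPf hk) mulr0n mulmx0.
  rewrite eqxx mulr1n -!scalemxAl -mulmxA mulmx_diag mul_delta_diag scalerA.
  by rewrite !mxE [mu 0 _ * _]mulrC mulrA.
rewrite scaler_suml; apply: eq_bigr => h _.
rewrite -!scalemxAl mul_delta_diag -scalemxAr -scalemxAl mul_delta_mx.
by rewrite !scalerA; congr (_ *: _); rewrite -!mulrA; congr (_ * _); rewrite mulrC.
Qed.

(** The hypothesis removes the product of the two off-diagonal parts, which could contribute only
    when k = g. *)
Lemma sum_rmxM d w d' w' (k g : 'I_r) :
  (forall h, w (f h) (f k) * w' (f k) (f h) = 0) ->
  \sum_h rmx d w k h *m rmx d' w' h g =
  diag_mx (\row_i (d i (f k) * d' i (f k))) *+ (k == g)
  + (d (f g) (f k) * w' (f g) (f k) + w (f g) (f k) * d' (f k) (f g))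
    *: delta_mx (f g) (f k).
Proof.
move=> ww'; under eq_bigr => h _ do rewrite /rmx !mulmxDl !mulmxDr.
rewrite !big_split /= -!addrA; congr (_ + _).
  rewrite (bigD1 k) //= big1 ?addr0 => [|h hk]; last first.
    by rewrite eq_sym (negPf hk) mulr0n mul0mx.
  rewrite eqxx mulr1n; case: eqP => _; last by rewrite mulr0n mulmx0.
  by rewrite !mulr1n !mulmx_diag; congr diag_mx; apply/rowP => i; rewrite !mxE.
rewrite scalerDl; congr (_ + _).
  rewrite (bigD1 k) //= big1 ?addr0 => [|h hk]; last first.
    by rewrite eq_sym (negPf hk) mulr0n mul0mx.
  by rewrite eqxx mulr1n -scalemxAr mul_diag_delta scalerA !mxE mulrC.
rewrite [X in _ + X]big1 ?addr0 => [|h _].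
  rewrite (bigD1 g) //= big1 ?addr0 => [|h hg]; last first.
    by rewrite (negPf hg) mulr0n mulmx0.
  by rewrite eqxx mulr1n -scalemxAl mul_delta_diag scalerA !mxE.
rewrite -scalemxAl -scalemxAr mul_delta_mx_cond scalerA.
have [kg|kg] := eqVneq (f k) (f g); last by rewrite mulr0n scaler0.
by rewrite -kg ww' scale0r.
Qed.

End Block.

(** * The block of R, its inverse, and the role of M *)

Section RBlock.
Variables (F : fieldType) (q : F) (n r c : nat) (f : 'I_r -> 'I_n).
Hypothesis fE : forall k, f k = (c + k)%N :> nat.
Hypothesis q0 : q != 0.
Variable e : int.
Hypothesis he : e = 1 \/ e = -1.

Lemma Roff_asym i k : Roff q e i k * Roff q e k i = 0.
Proof.
rewrite /Roff; case E: (Rflip e i k); rewrite ?mul0r //.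
by rewrite Rflip_asym ?E // mulr0.
Qed.

Lemma Rdiag_inv i k : Rdiag q e i k * - Rdiag q (- e) i k = 1.
Proof.
rewrite mulrN /Rdiag; case: eqP => _; first by rewrite acoefN // opprK.
by rewrite bcoefN mulrN bcoef_sq // opprK.
Qed.

Lemma Roff_diag i k : Roff q e i k * (Rdiag q e i k + Rdiag q (- e) i k) = 0.
Proof.
rewrite /Roff /Rdiag /Rflip; case: eqP => _ /=; first by rewrite mul0r.
by rewrite bcoefN subrr mulr0.
Qed.

Definition Rblk : 'I_r -> 'I_r -> 'M[F]_n :=
  rmx f (fun i k => Rdiag q e i k) (fun i k => Roff q e i k).
(** By unitarity, this is the block of - R_21 in degree -e. Exchanging the spaces and negating the
    degree cancel each other in the off-diagonal coefficients, so [Roff] keeps the degree e. *)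
Definition Rblk_inv : 'I_r -> 'I_r -> 'M[F]_n :=
  rmx f (fun i k => - Rdiag q (- e) i k) (fun i k => - Roff q e i k).

Lemma Rblk_mulV k g : \sum_h Rblk k h *m Rblk_inv h g = 1%:M *+ (k == g).
Proof.
rewrite sum_rmxM; last by move=> h; rewrite mulrN Roff_asym oppr0.
rewrite (RdiagC q (- e) (f k)) [Rdiag _ _ _ _ * - Roff _ _ _ _]mulrN mulrN.
rewrite [Rdiag _ _ _ _ * Roff _ _ _ _]mulrC -opprD -mulrDr Roff_diag oppr0 scale0r addr0.
congr (_ *+ _); rewrite -diag_const_mx; congr diag_mx; apply/rowP => i.
by rewrite !mxE Rdiag_inv.
Qed.

Lemma Rblk_mulVl k g : \sum_h Rblk_inv k h *m Rblk h g = 1%:M *+ (k == g).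
Proof.
rewrite sum_rmxM; last by move=> h; rewrite mulNr Roff_asym oppr0.
rewrite (RdiagC q e (f k)) mulNr mulNr.
rewrite [Rdiag _ _ _ _ * Roff _ _ _ _]mulrC -opprD -mulrDr.
rewrite addrC [_ + Rdiag _ e _ _]addrC Roff_diag oppr0 scale0r add0r.
congr (_ *+ _); rewrite -diag_const_mx; congr diag_mx; apply/rowP => i.
by rewrite !mxE mulrC Rdiag_inv.
Qed.

Lemma sum_between (V : zmodType) (phi : nat -> V) a b : (a < b)%N -> (b < r)%N ->
  \sum_(h < r | (a < h < b)%N) (phi h - phi h.+1) = phi a.+1 - phi b.
Proof.
move=> ab br; rewrite -(big_mkord (fun h => a < h < b)%N (fun h => phi h - phi h.+1)).
transitivity (\sum_(a.+1 <= h < b) (phi h - phi h.+1)).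
  rewrite [RHS](big_nat_widen _ _ r) ?(ltnW br) // [RHS](big_nat_widenl _ 0) //.
  by apply: eq_bigl => h; rewrite andbC.
rewrite -[LHS]opprK -sumrN; under eq_bigr do rewrite opprB.
by rewrite telescope_sumr // opprB.
Qed.

Variable theta : F.
Local Notation mu i := (theta * q ^ (n%:Z - 2 * (f i).+1%:Z + 1)).
(** The exponents in M decrease by 2 at each index, so q mu_h and q^-1 mu_h are consecutive values
    of [phi], and sums of (q - q^-1) mu_h telescope. *)
Let phi (t : nat) : F := theta * q ^ (n%:Z - 2 * (c + t)%:Z).

Let mu_q h : q * mu h = phi h.
Proof.
rewrite mulrCA /phi fE; congr (_ * _); rewrite -{1}[q]expr1z -expfzDr //.
by congr (_ ^ _); rewrite intS !PoszD; ring.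
Qed.

Let mu_qV h : q^-1 * mu h = phi h.+1.
Proof.
rewrite mulrCA /phi fE; congr (_ * _); rewrite -[q^-1]exprN1 -expfzDr //.
by congr (_ ^ _); rewrite addnS !intS !PoszD; ring.
Qed.

Let Roff_sum (g k : 'I_r) : \sum_(h < r) Roff q e g h * Roff q e h k * mu h =
  (q - q^-1) * \sum_(h < r | Rflip e g h && Rflip e h k) (phi h - phi h.+1).
Proof.
rewrite [in RHS]big_mkcond mulr_sumr; apply: eq_bigr => h _.
rewrite /Roff -mu_q -mu_qV; case: (Rflip e g h); case: (Rflip e h k);
  rewrite /= ?mulr0n ?mulr1n; ring.
Qed.

(** The first two terms pair a flip with a diagonal coefficient. The sum over products of two flips
    runs over the indices strictly between g and k, and telescopes to exactly what cancels them. *)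
Let Roff_trace (g k : 'I_r) :
  - (Roff q e g k * acoef q (- e) * mu g) - Roff q e g k * acoef q e * mu k
  - \sum_(h < r) Roff q e g h * Roff q e h k * mu h = 0.
Proof.
rewrite Roff_sum /Roff; case: he => ->.
  under eq_bigl do rewrite !Rflip1.
  rewrite Rflip1; have [gk|kg] := ltnP g k; last first.
    rewrite big_pred0 => [|h]; first by rewrite mulr0n !mul0r mulr0; ring.
    by apply/negP => /andP[gh hk]; move: (ltn_trans gh hk); rewrite ltnNge kg.
  rewrite sum_between //= -mu_qV -mu_q /acoef /= mulr1n !mulr0n; ring.
under eq_bigl do rewrite !RflipN1 andbC.
rewrite RflipN1; have [kg|gk] := ltnP k g; last first.
  rewrite big_pred0 => [|h]; first by rewrite mulr0n !mul0r mulr0; ring.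
  by apply/negP => /andP[kh hg]; move: (ltn_trans kh hg); rewrite ltnNge gk.
rewrite sum_between //= -mu_qV -mu_q /acoef opprK /= mulr1n !mulr0n; ring.
Qed.

(* This is what determines M: the off-diagonal terms telescope. *)
Lemma Rblk_trace k g :
  \sum_h Rblk_inv h g *m Kplus q theta n *m Rblk k h = Kplus q theta n *+ (k == g).
Proof.
rewrite /Kplus sum_rmx_trace -[RHS]addr0; congr (_ + _).
  have [->|//] := eqVneq k g; rewrite !mulr1n; congr diag_mx.
  by apply/rowP => i; rewrite !mxE mulrAC [- _ * _]mulrC Rdiag_inv mul1r.
apply/eqP; rewrite scaler_eq0; apply/orP; left; apply/eqP.
rewrite -[RHS](Roff_trace g k) -sumrN !mxE !(Roff_block _ fE).
rewrite /Rdiag !eqxx !(mulrN, mulNr); congr (_ + _).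
by apply: eq_bigr => h _; rewrite !mxE !(Roff_block _ fE) !mulNr.
Qed.

End RBlock.

(** * Commutation with the transfer matrix *)

Section Commutation.
Variables (F : fieldType) (A : algType F) (q : F) (n r c : nat) (f : 'I_r -> 'I_n).
Hypothesis fE : forall k, f k = (c + k)%N :> nat.
Hypothesis q0 : q != 0.
Variable e : int.
Hypothesis he : e = 1 \/ e = -1.

Local Notation N := 'M['M[A]_n]_r.
Local Notation auxm X := ((X : 'M[A]_n)%:M : N).

(* An operator on the auxiliary space tensored with the block is represented by a
   matrix over ['M[A]_n], so that X_1 becomes a scalar matrix. *)
Definition nestR : N := \matrix_(k, h) scalmx A (Rblk q f e k h).
Definition nestR_inv : N := \matrix_(k, h) scalmx A (Rblk_inv q f e k h).
Definition nestQ (Y : 'M[A]_n) : N := \matrix_(k, h) (Y (f k) (f h))%:M.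

Lemma nest_mulr (U : N) X k h : (U * auxm X) k h = U k h *m X.
Proof.
rewrite mxE (bigD1 h) //= big1 ?addr0 => [|g gh]; rewrite mxE ?eqxx ?mulr1n //.
by rewrite (negPf gh) mulr0n mulr0.
Qed.

Lemma nest_mull (U : N) X k h : (auxm X * U) k h = X *m U k h.
Proof.
rewrite mxE (bigD1 k) //= big1 ?addr0 => [|g gk]; rewrite mxE ?eqxx ?mulr1n //.
by rewrite eq_sym (negPf gk) mulr0n mul0r.
Qed.

Lemma nestME (U V : N) k h : (U * V) k h = \sum_g U k g *m V g h.
Proof. by rewrite mxE. Qed.

Lemma mul_mx_scalE m (M : 'M[A]_m) y i j : (M *m y%:M) i j = M i j * y.
Proof.
rewrite mxE (bigD1 j) //= big1 ?addr0 => [|g gj]; rewrite mxE ?eqxx ?mulr1n //.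
by rewrite (negPf gj) mulr0n mulr0.
Qed.

Lemma scalmx_mulE m (M : 'M[F]_m) (X : 'M[A]_m) i j :
  (scalmx A M *m X) i j = \sum_a M i a *: X a j.
Proof. by rewrite mxE; apply: eq_bigr => a _; rewrite mxE mulr_algl. Qed.

Lemma mul_scalmxE m (M : 'M[F]_m) (X : 'M[A]_m) i j :
  (X *m scalmx A M) i j = \sum_a M a j *: X i a.
Proof. by rewrite mxE; apply: eq_bigr => a _; rewrite mxE mulr_algr. Qed.

Lemma rmx_mulE d w (k g : 'I_r) (X : 'M[A]_n) i j :
  (scalmx A (rmx f d w k g) *m X) i j =
  (d i (f k) *: X i j) *+ (k == g) + (w (f g) (f k) *: X (f k) j) *+ (i == f g).
Proof.
rewrite scalmx_mulE /rmx; under eq_bigr => a _ do rewrite mxE scalerDl.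
rewrite big_split /=; congr (_ + _).
  rewrite (bigD1 i) //= big1 ?addr0 => [|a ai].
    by case: (k == g); rewrite !mxE ?eqxx ?scale0r.
  by case: (k == g); rewrite !mxE ?scale0r // eq_sym (negPf ai) scale0r.
rewrite (bigD1 (f k)) //= big1 ?addr0 => [|a ak]; rewrite !mxE.
  by rewrite eqxx andbT mulr_natr -scalerMnl.
by rewrite (negPf ak) andbF mulr0 scale0r.
Qed.

Lemma mul_rmxE d w (g h : 'I_r) (X : 'M[A]_n) i j :
  (X *m scalmx A (rmx f d w g h)) i j =
  (d j (f g) *: X i j) *+ (g == h) + (w (f h) (f g) *: X i (f h)) *+ (j == f g).
Proof.
rewrite mul_scalmxE /rmx; under eq_bigr => a _ do rewrite mxE scalerDl.
rewrite big_split /=; congr (_ + _).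
  rewrite (bigD1 j) //= big1 ?addr0 => [|a aj].
    by case: (g == h); rewrite !mxE ?eqxx ?scale0r.
  by case: (g == h); rewrite !mxE ?scale0r // (negPf aj) scale0r.
rewrite (bigD1 (f h)) //= big1 ?addr0 => [|a ah]; rewrite !mxE.
  by rewrite eqxx mulr_natr -scalerMnl.
by rewrite (negPf ah) mulr0 scale0r.
Qed.

Lemma scalmx_sum (I : finType) (G : I -> 'M[F]_n) :
  scalmx A (\sum_i G i) = \sum_i scalmx A (G i).
Proof. exact: raddf_sum. Qed.

Lemma scalmx_delta m (b : bool) : scalmx A (1%:M *+ b : 'M_m) = 1%:M *+ b.
Proof. by case: b; rewrite ?mulr1n ?mulr0n ?scalmx1 // /scalmx map_mx0. Qed.

Lemma nestR_mulV : nestR * nestR_inv = 1.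
Proof.
apply/matrixP => k g; rewrite !mxE -(scalmx_delta _ (k == g)).
rewrite -(Rblk_mulV f q0 he) scalmx_sum; apply: eq_bigr => h _.
by rewrite !mxE scalmxM.
Qed.

Lemma nestR_mulVl : nestR_inv * nestR = 1.
Proof.
apply/matrixP => k g; rewrite !mxE -(scalmx_delta _ (k == g)).
rewrite -(Rblk_mulVl f q0 he) scalmx_sum; apply: eq_bigr => h _.
by rewrite !mxE scalmxM.
Qed.

Lemma sum_codom (G : 'I_n -> A) i : (i \notin codom f -> G i = 0) ->
  \sum_(g < r) G (f g) *+ (i == f g) = G i.
Proof.
move=> G0; have [|/[dup] /G0-> /negP fi] := boolP (i \in codom f); last first.
  rewrite big1 // => g _; case: eqP => // ig.
  by case: fi; rewrite ig codom_f.
case/codomP => g ->; rewrite (bigD1 g) //= eqxx big1 ?addr0 // => h hg.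
by rewrite (inj_eq (block_inj fE)) eq_sym (negPf hg).
Qed.

Section Intertwine.
Variable Y : 'M[A]_n.
(** Together with [Yrow], this says that whenever R flips a block index with an index outside, the
    entry of [Y] that is reached vanishes. Triangular matrices satisfy it for the right sign of
    [e]. *)
Hypothesis Ycol : forall i k h, i \notin codom f ->
  ~~ Rflip e i (f k) \/ Y i (f h) = 0.
Hypothesis Yrow : forall j k h, j \notin codom f ->
  ~~ Rflip e (f h) j \/ Y (f k) j = 0.

(** In the matrix product the intermediate index of the second space stays in the block; the terms
    of [RLL0E] with that index outside vanish by [Ycol] and [Yrow]. *)
Lemma RLL0_nest X : RLL0 (Rcoef q n e) X Y ->
  nestR * auxm X * nestQ Y = nestQ Y * auxm X * nestR.
Proof.
move/RLL0E => RXY; apply/matrixP => k h; apply/matrixP => i j.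
transitivity (Rdiag q e i (f k) *: (X i j * Y (f k) (f h)) +
              Roff q e i (f k) *: (X (f k) j * Y i (f h))).
  rewrite -(@sum_codom (fun i => Roff q e i (f k) *: (X (f k) j * Y i (f h)))); last first.
    move=> ic; have [/negPf e0|->] := @Ycol _ k h ic; last by rewrite mulr0 scaler0.
    by rewrite /Roff e0 scale0r.
  rewrite nestME summxE.
  under eq_bigr => g _ do
    rewrite nest_mulr [nestR _ _]mxE [nestQ _ _ _]mxE mul_mx_scalE rmx_mulE mulrDl.
  rewrite big_split /=; congr (_ + _).
    rewrite (bigD1 k) //= big1 ?addr0 => [|g gk]; first by rewrite eqxx scalerAl.
    by rewrite eq_sym (negPf gk) mulr0n mul0r.
  by apply: eq_bigr => g _; rewrite mulrnAl scalerAl.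
rewrite RXY -(@sum_codom (fun j => Roff q e (f h) j *: (Y (f k) j * X i (f h)))); last first.
  move=> jc; have [/negPf e0|->] := @Yrow _ k h jc; last by rewrite mul0r scaler0.
  by rewrite /Roff e0 scale0r.
rewrite nestME summxE.
under [RHS]eq_bigr => g _ do
  rewrite nest_mulr [nestQ _ _ _]mxE [nestR _ _]mxE -mulmxA mul_scalar_mx mxE mul_rmxE mulrDr.
rewrite big_split /=; congr (_ + _).
  rewrite (bigD1 h) //= big1 ?addr0 => [|g gh]; first by rewrite eqxx scalerAr.
  by rewrite (negPf gh) mulr0n mulr0.
by apply: eq_bigr => g _; rewrite mulrnAr scalerAr.
Qed.

Lemma auxmM X Z : auxm (X *m Z) = auxm X * auxm Z.
Proof. exact: scalar_mxM. Qed.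

(** The diagonal part of R commutes with any diagonal matrix, and its flips only exchange auxiliary
    indices of the block, where [u] is constant. *)
Lemma nestR_diag (u : 'rV[F]_n) : (forall a b, u 0 (f a) = u 0 (f b)) ->
  auxm (scalmx A (diag_mx u)) * nestR = nestR * auxm (scalmx A (diag_mx u)).
Proof.
move=> uf; apply/matrixP => k h; rewrite nest_mulr nest_mull mxE.
rewrite -!scalmxM; congr scalmx; rewrite /Rblk /rmx mulmxDr mulmxDl; congr (_ + _).
  case: (k == h); last by rewrite mulmx0 mul0mx.
  by rewrite !mulr1n; apply: diag_mxC.
by rewrite -scalemxAl -scalemxAr mul_diag_delta mul_delta_diag (uf h k).
Qed.

Lemma nestQ_scalmx (M : 'M[F]_n) : auxm (scalmx A M) * nestQ Y = nestQ Y * auxm (scalmx A M).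
Proof.
apply/matrixP => k h; rewrite nest_mulr nest_mull mxE; apply/matrixP => i j.
by rewrite mul_mx_scalE mul_scalar_mx !mxE mulr_algl mulr_algr.
Qed.

Lemma mxtrace_scalmxC (M : 'M[F]_n) (X : 'M[A]_n) : \tr (scalmx A M *m X) = \tr (X *m scalmx A M).
Proof.
rewrite /mxtrace; under eq_bigr => i _ do rewrite scalmx_mulE.
by rewrite exchange_big; apply: eq_bigr => a _ /=; rewrite mul_scalmxE.
Qed.

(** This is Y_2 X_1 = R X_1 R^-1 Y_2 on the block. *)
Definition conj_invariant X := nestQ Y * auxm X = nestR * auxm X * nestR_inv * nestQ Y.

Lemma conj_invariant_sum (I : finType) (G : I -> 'M[A]_n) :
  (forall i, conj_invariant (G i)) -> conj_invariant (\sum_i G i).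
Proof.
move=> GE; apply: big_ind => // [|X Z XE ZE].
  by rewrite /conj_invariant raddf0 !(mulr0, mul0r).
by rewrite /conj_invariant raddfD /= mulrDr XE ZE mulrDr !mulrDl.
Qed.

Lemma conj_invariant_comm theta (X : 'M[A]_n) k h : conj_invariant X ->
  GRing.comm (Y (f k) (f h)) (\tr (scalmx A (Kplus q theta n) *m X)).
Proof.
set M := Kplus q theta n => XE.
have trM y : \tr (scalmx A M *m (y%:M *m X)) = y * \tr (scalmx A M *m X).
  rewrite /mxtrace mulr_sumr; apply: eq_bigr => i _.
  rewrite !scalmx_mulE mulr_sumr; apply: eq_bigr => a _.
  by rewrite mul_scalar_mx [X in _ *: X]mxE scalerAr.
have trMr (Z : 'M[A]_n) y : \tr (scalmx A M *m (Z *m y%:M)) = \tr (scalmx A M *m Z) * y.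
  rewrite mulmxA /mxtrace mulr_suml; apply: eq_bigr => i _.
  by rewrite mul_mx_scalE.
have := congr1 (fun U : N => \tr (scalmx A M *m U k h)) XE.
rewrite /= nest_mulr nestME [nestQ _ _ _]mxE trM /GRing.comm => ->.
rewrite mulmx_sumr raddf_sum /=.
under eq_bigr => g _ do rewrite [nestQ _ _ _]mxE trMr.
(* R^-1 has scalar entries, so it can be moved cyclically to the front of M although X has
   noncommuting entries; [Rblk_trace] then applies. *)
have trW g : \tr (scalmx A M *m (nestR * auxm X * nestR_inv) k g) =
    \tr (scalmx A M *m X) *+ (k == g).
  rewrite nestME mulmx_sumr raddf_sum /=.
  under eq_bigr => a _ do rewrite nest_mulr [nestR _ _]mxE [nestR_inv _ _]mxE
    mulmxA -mxtrace_scalmxC !mulmxA -!scalmxM.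
  rewrite -raddf_sum -mulmx_suml -scalmx_sum (Rblk_trace fE q0 he).
  by case: (k == g); rewrite ?mulr1n // mulr0n /scalmx map_mx0 mul0mx raddf0.
under eq_bigr => g _ do rewrite trW.
rewrite (bigD1 k) //= big1 ?addr0 => [|g gk]; first by rewrite eqxx mulr1n.
by rewrite eq_sym (negPf gk) mulr0n mul0r.
Qed.

Variables Tp Tm S : nat -> 'M[A]_n.
Hypothesis RTp : forall k, RLL0 (Rcoef q n e) (Tp k) Y.
Hypothesis RTm : forall k, RLL0 (Rcoef q n e) (Tm k) Y.
Hypothesis TmS : smul Tm S = smon A n 0.
Hypothesis STm : smul S Tm = smon A n 0.
Variable u : nat -> 'rV[F]_n.
Hypothesis uf : forall k a b, u k 0 (f a) = u k 0 (f b).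

Lemma block_comm_transfer theta j k h :
  GRing.comm (Y (f k) (f h))
    (transfer q theta (smul (smul Tp (fun i => scalmx A (diag_mx (u i)))) S) j).
Proof.
apply: conj_invariant_comm; rewrite /smul; apply: conj_invariant_sum => i.
rewrite mulmx_suml; apply: conj_invariant_sum => i'.
set T := Tp _; set K := scalmx _ _; set s := S _.
(* With Q for [nestQ Y], the relation R T Q = Q T R reads T (Q R^-1) = (R^-1 Q) T; the inverse
   series therefore intertwines the same two operators in the opposite order. *)
have sE : auxm s * (nestR_inv * nestQ Y) = (nestQ Y * nestR_inv) * auxm s.
  apply: (@inverse_intertwiner N (fun k => auxm (Tm k)) (fun k => auxm (S k))).
  - move=> l; rewrite -[(l == 0)%:R](_ : auxm (smon A n 0 l) = _); last first.
      by rewrite /smon; case: eqP => _; rewrite ?mulr1n ?mulr0n //= raddf0 raddf0.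
    by rewrite -STm /smul raddf_sum; apply: eq_bigr => ? _; rewrite -auxmM.
  - by rewrite -auxmM -smul0 TmS /smon eqxx.
  move=> l; apply: (@etrans _ _ (nestR_inv * (nestR * auxm (Tm l) * nestQ Y) * nestR_inv)).
    by rewrite !mulrA nestR_mulVl mul1r.
  by rewrite (RLL0_nest (RTm l)) -!mulrA nestR_mulV mulr1.
rewrite /conj_invariant !auxmM.
(* Here Q T K s = Q T K R R^-1 s = Q T R K R^-1 s = R T Q K R^-1 s = R T K Q R^-1 s = R T K s R^-1
   Q. *)
transitivity (nestQ Y * auxm T * auxm K * (nestR * nestR_inv) * auxm s).
  by rewrite nestR_mulV mulr1 !mulrA.
rewrite !mulrA -[_ * auxm K * nestR]mulrA nestR_diag // mulrA.
rewrite -(RLL0_nest (RTp _)) -/T -[_ * nestQ Y * auxm K]mulrA -nestQ_scalmx.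
by rewrite -!mulrA; do 3 congr (_ * _); rewrite mulrA -sE.
Qed.

End Intertwine.

End Commutation.

(** * Level-zero limits and the monodromy matrix *)

Section Revrank.
Variable n : nat.

Definition revrank (i : 'I_n) : nat := rev_ord i.

Lemma revrank_inj : injective revrank.
Proof. by move=> i j /val_inj/rev_ord_inj. Qed.

Lemma ltn_revrank i j : (revrank i < revrank j)%N = (j < i)%N.
Proof. by rewrite /revrank /= ltn_subLR ?subnS; have := ltn_ord i; have := ltn_ord j; lia. Qed.

End Revrank.

Section Limits.
Variables (F : fieldType) (A : algType F) (q : F) (n : nat).
Implicit Types (X Y : int -> 'M[A]_n) (L : nat -> 'M[A]_n).

Lemma inj1_0 : inj1 (0 : 'M[A]_n) = 0.
Proof. exact: tens0mx. Qed.

Lemma inj2_0 : inj2 (0 : 'M[A]_n) = 0.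
Proof. exact: tensmx0. Qed.

(** In the coefficient of z^(a+1) w^(b-1), the degree 1 part of R meets X_a and Y_b, while the
    degree -1 part meets X_(a+2) and Y_(b-2), one of which is zero. *)
Lemma RLL_RLL0 X Y a b : RLL q X Y -> X (a + 2) = 0 \/ Y (b - 2) = 0 ->
  RLL0 (Rcoef q n 1) (X a) (Y b).
Proof.
move=> RXY XY0; have := RXY (a + 1) (b - 1); rewrite !big_cons !big_nil !addr0.
have [-> -> -> ->] : [/\ a + 1 - 1 = a, b - 1 + 1 = b, a + 1 - -1 = a + 2
    & b - 1 + -1 = b - 2] by split; ring.
rewrite /RLL0 => RXY'; move: XY0 RXY'.
by case=> ->; rewrite ?inj1_0 ?inj2_0 !(mulmx0, mul0mx) !addr0.
Qed.

Lemma RLL_RLL0N X Y a b : RLL q X Y -> X (a - 2) = 0 \/ Y (b + 2) = 0 ->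
  RLL0 (Rcoef q n (-1)) (X a) (Y b).
Proof.
move=> RXY XY0; have := RXY (a - 1) (b + 1); rewrite !big_cons !big_nil !addr0.
have [-> -> -> ->] : [/\ a - 1 - -1 = a, b + 1 + -1 = b, a - 1 - 1 = a - 2
    & b + 1 + 1 = b + 2] by split; ring.
rewrite /RLL0 => RXY'; move: XY0 RXY'.
by case=> ->; rewrite ?inj1_0 ?inj2_0 !(mulmx0, mul0mx) !add0r.
Qed.

Lemma zcoef_plus_neg L (k : nat) : zcoef_plus L (- k.+1%:Z) = 0.
Proof. by []. Qed.

Lemma zcoef_plus_double L k : zcoef_plus L k.*2%:Z = L k.
Proof. by rewrite /= odd_double doubleK. Qed.

Hypothesis q0 : q != 0.

(* The limits w -> 0 and w -> oo of the defining relations. *)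
Lemma Uqglhat_level_zero (Lp Lm : nat -> 'M[A]_n) : Uqglhat_rel q Lp Lm ->
  [/\ forall k, RLL0 (Rcoef q n 1) (Lp k) (Lp 0%N),
      forall k, RLL0 (Rcoef q n 1) (Lm k) (Lp 0%N),
      forall k, RLL0 (Rcoef q n (-1)) (Lp k) (Lm 0%N)
    & forall k, RLL0 (Rcoef q n (-1)) (Lm k) (Lm 0%N)].
Proof.
case=> Rpp Rmm Rpm _.
have m0 : zcoef_minus Lm 0 = Lm 0%N by [].
have mk k : zcoef_minus Lm (- k.*2%:Z) = Lm k.
  by rewrite /zcoef_minus opprK zcoef_plus_double.
split=> k.
- rewrite -(zcoef_plus_double Lp k); apply: (RLL_RLL0 (b := 0) Rpp); right.
  exact: (zcoef_plus_neg _ 1).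
(* The defining relations have L^+ in the first space and L^- in the second; the opposite order
   comes from the degree -1 limit by [RLL0_sym]. *)
- rewrite -[1]opprK; apply: RLL0_sym => //.
  rewrite -(mk k); apply: (RLL_RLL0N (a := 0) Rpm); left.
  exact: (zcoef_plus_neg _ 1).
- rewrite -(zcoef_plus_double Lp k) -m0; apply: (RLL_RLL0N Rpm); right.
  exact: (zcoef_plus_neg _ 1).
- rewrite -(mk k) -m0; apply: (RLL_RLL0N Rmm); right.
  exact: (zcoef_plus_neg _ 1).
Qed.

(** * Products over the sites of the chain *)

Lemma inj1M (X Y : 'M[A]_n) : inj1 (X *m Y) = inj1 X *m inj1 Y.
Proof.
apply/matrixP => x y; case: (mxtens_indexP x) => i k.
case: (mxtens_indexP y) => j h; rewrite mul_inj1E /inj1 tensmxE !mxE mulr_suml.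
by apply: eq_bigr => a _; rewrite tensmxE !mxE !mulr_natr mulrnAl.
Qed.

Lemma inj2M (X Y : 'M[A]_n) : inj2 (X *m Y) = inj2 X *m inj2 Y.
Proof. by rewrite -!mxswap_inj1 inj1M mxswapM. Qed.

Lemma inj12_comm (X Y : 'M[A]_n) :
  (forall x y, entries X x -> entries Y y -> GRing.comm x y) ->
  inj1 X *m inj2 Y = inj2 Y *m inj1 X.
Proof.
move=> XY; apply/matrixP => x y; case: (mxtens_indexP x) => i k.
case: (mxtens_indexP y) => j h; rewrite mul_inj1E mul_inj2E.
rewrite [RHS](bigD1 i) //= [X in _ = _ + X]big1 ?addr0 => [|a ai]; last first.
  by rewrite inj2E eq_sym (negPf ai) mulr0n mul0r.
rewrite (bigD1 k) //= big1 ?addr0 => [|g gk]; last first.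
  by rewrite /inj1 tensmxE !mxE eq_sym (negPf gk) mulr0 mul0r.
rewrite inj2E /inj1 tensmxE !mxE !eqxx mulr1 mulr1n.
by apply: XY; [exists i, j|exists k, h].
Qed.

(** The coproduct argument: R X_1 X'_1 Y_2 Y'_2 = R X_1 Y_2 X'_1 Y'_2 = Y_2 X_1 R X'_1 Y'_2 = Y_2
    X_1 Y'_2 X'_1 R = Y_2 Y'_2 X_1 X'_1 R. *)
Lemma RLL0M (R : 'M[F]_(n * n)) (X X' Y Y' : 'M[A]_n) :
  (forall x y, entries X' x -> entries Y y -> GRing.comm x y) ->
  (forall x y, entries X x -> entries Y' y -> GRing.comm x y) ->
  RLL0 R X Y -> RLL0 R X' Y' -> RLL0 R (X *m X') (Y *m Y').
Proof.
move=> /inj12_comm X'Y /inj12_comm XY' RXY RX'Y'; rewrite /RLL0 !inj1M !inj2M.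
rewrite !mulmxA -[_ *m inj1 X' *m inj2 Y]mulmxA X'Y !mulmxA RXY.
rewrite -!mulmxA (mulmxA (scalmx A R)) RX'Y' !mulmxA.
by rewrite -[_ *m inj1 X *m inj2 Y']mulmxA XY' !mulmxA.
Qed.

Lemma RLL0_suml (R : 'M[F]_(n * n)) (I : finType) (X : I -> 'M[A]_n) (Y : 'M[A]_n) :
  (forall i, RLL0 R (X i) Y) -> RLL0 R (\sum_i X i) Y.
Proof.
move=> RX; have injS : inj1 (\sum_i X i) = \sum_i inj1 (X i).
  apply/matrixP => x y; case: (mxtens_indexP x) => i k.
  case: (mxtens_indexP y) => j h; rewrite summxE /inj1 tensmxE summxE mulr_suml.
  by apply: eq_bigr => a _; rewrite tensmxE.
rewrite /RLL0 injS !mulmx_sumr !mulmx_suml; apply: eq_bigr => i _; exact: RX.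
Qed.

Lemma RLL0_1 (R : 'M[F]_(n * n)) : RLL0 R (1%:M : 'M[A]_n) 1%:M.
Proof.
rewrite /RLL0; have -> : inj1 (1%:M : 'M[A]_n) = 1%:M.
  apply/matrixP => x y; case: (mxtens_indexP x) => i k.
  case: (mxtens_indexP y) => j h; rewrite /inj1 tensmxE !mxE -natrM mulnb.
  by rewrite (can_eq (@mxtens_indexK n n)).
have -> : inj2 (1%:M : 'M[A]_n) = 1%:M.
  apply/matrixP => x y; case: (mxtens_indexP x) => i k.
  case: (mxtens_indexP y) => j h; rewrite /inj2 tensmxE !mxE -natrM mulnb.
  by rewrite (can_eq (@mxtens_indexK n n)).
by rewrite !mulmx1 !mul1mx.
Qed.

Lemma RLL0_0 (R : 'M[F]_(n * n)) (Y : 'M[A]_n) : RLL0 R 0 Y.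
Proof. by rewrite /RLL0 inj1_0 ?(mulmx0, mul0mx). Qed.

Lemma commutant_subalg (P : A -> Prop) : subalg (fun x => forall y, P y -> GRing.comm x y).
Proof.
split=> [a|x z xP zP|x z xP zP] y Py; apply: commr_sym.
- by rewrite /GRing.comm mulr_algl mulr_algr.
- by apply: commrD; apply: commr_sym; [apply: xP|apply: zP].
- by apply: commrM; apply: commr_sym; [apply: xP|apply: zP].
Qed.

Lemma monodromyS N (L : 'I_N.+1 -> nat -> 'M[A]_n) :
  monodromy L = smul (L ord0) (monodromy (fun s => L (lift ord0 s))).
Proof. exact: big_ord_recl. Qed.

Lemma monodromy0 N (L : 'I_N.+1 -> nat -> 'M[A]_n) :
  monodromy L 0%N = L ord0 0%N *m monodromy (fun s => L (lift ord0 s)) 0%N.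
Proof. by rewrite monodromyS smul0. Qed.

Lemma monodromy_in (S : A -> Prop) N (L : 'I_N -> nat -> 'M[A]_n) k : subalg S ->
  (forall s k, mx_in S (L s k)) -> mx_in S (monodromy L k).
Proof.
move=> aS; elim: N L k => [|N IH] L k SL.
  rewrite /monodromy big_ord0 /smon => i j; rewrite mxE.
  by case: (_ == _); case: (_ == _); rewrite ?mulr1n ?mulr0n;
     [apply: subalg1|apply: subalg0|apply: subalg0|apply: subalg0].
rewrite monodromyS /smul => i j; rewrite summxE; apply: subalg_sum => // l _.
by apply: mx_inM => //; apply: IH.
Qed.

Lemma monodromy_comm N (L : 'I_N -> nat -> 'M[A]_n) k (y : A) :
  (forall s l x, entries (L s l) x -> GRing.comm x y) ->
  forall x, entries (monodromy L k) x -> GRing.comm x y.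
Proof.
move=> Ly x [i [j ->]]; have aS := commutant_subalg (eq y).
apply: (monodromy_in (L := L) k aS) => // s l a b _ <-.
by apply: (Ly s l); exists a, b.
Qed.

Lemma monodromy_RLL0 (R : 'M[F]_(n * n)) N (L L' : 'I_N -> nat -> 'M[A]_n) k :
  (forall s l, RLL0 R (L s l) (L' s 0%N)) ->
  (forall (s t : 'I_N) l l' x y, s != t ->
     entries (L s l) x -> entries (L' t l') y -> GRing.comm x y) ->
  RLL0 R (monodromy L k) (monodromy L' 0%N).
Proof.
elim: N L L' k => [|N IH] L L' k RL LL'.
  rewrite /monodromy !big_ord0 /smon; case: (k == 0); first exact: RLL0_1.
  by rewrite (_ : _%:R%:M = 0) ?raddf0 //; apply: RLL0_0.
rewrite monodromy0 monodromyS; apply: RLL0_suml => l; apply: RLL0M => //.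
- move=> x y Lx L'y; apply: monodromy_comm Lx => s l' x' Lx'.
  by apply: LL' Lx' L'y.
- move=> x y Lx L'y; apply/commr_sym; apply: monodromy_comm L'y => s l' y' L'y'.
  by apply/commr_sym; apply: LL' Lx L'y'.
- by apply: IH => [s l'|s t l1 l2 x y st]; [apply: RL|apply: LL'; rewrite (inj_eq lift_inj)].
Qed.

Lemma level_zero_triangular (X Y : 'M[A]_n) : level_zero X Y <->
  [/\ triangular val X, triangular (@revrank n) Y,
      forall a, X a a * Y a a = 1 & forall a, Y a a * X a a = 1].
Proof.
split=> [[XY0 XY1]|[tX tY XY YX]].
  split=> [i j /XY0[]//|i j|a|a]; first by rewrite ltn_revrank => /XY0[].
    by have [] := XY1 a.
  by have [] := XY1 a.
split=> [a b ab|a //]; split; first exact: tX.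
by apply: tY; rewrite ltn_revrank.
Qed.

Lemma level_zeroM (X Y X' Y' : 'M[A]_n) :
  (forall x y, entries X' x -> entries Y y -> GRing.comm x y) ->
  (forall x y, entries Y' x -> entries X y -> GRing.comm x y) ->
  level_zero X Y -> level_zero X' Y' -> level_zero (X *m X') (Y *m Y').
Proof.
move=> X'Y Y'X /level_zero_triangular[tX tY XY YX].
move=> /level_zero_triangular[tX' tY' XY' YX'].
apply/level_zero_triangular; split; [exact: triangularM|exact: triangularM|move=> a|move=> a].
all: rewrite (triangularM_diag val_inj a tX tX') (triangularM_diag (@revrank_inj n) a tY tY').
- have cXY : X' a a * Y a a = Y a a * X' a a by apply: X'Y; exists a, a.
  by rewrite mulrA -[_ * X' a a * _]mulrA cXY mulrA XY mul1r XY'.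
- have cXY : Y' a a * X a a = X a a * Y' a a by apply: Y'X; exists a, a.
  by rewrite mulrA -[_ * Y' a a * _]mulrA cXY mulrA YX mul1r YX'.
Qed.

Lemma monodromy_level_zero N (L L' : 'I_N -> nat -> 'M[A]_n) :
  (forall s, level_zero (L s 0%N) (L' s 0%N)) ->
  (forall (s t : 'I_N) l l' x y, s != t ->
     entries (L s l) x -> entries (L' t l') y -> GRing.comm x y) ->
  level_zero (monodromy L 0%N) (monodromy L' 0%N).
Proof.
elim: N L L' => [|N IH] L L' L0 LL'.
  rewrite /monodromy !big_ord0 /smon; apply/level_zero_triangular.
  by split; [exact: triangular1|exact: triangular1| |] => a;
     rewrite !mxE !eqxx !mulr1n mulr1.
rewrite !monodromy0; apply: level_zeroM => //.
- move=> x y Lx L'y; apply: monodromy_comm Lx => s l' x' Lx'.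
  by apply: LL' Lx' L'y.
- move=> x y L'x Ly; apply: monodromy_comm L'x => s l' x' L'x'.
  by apply/commr_sym; apply: LL' Ly L'x'.
- by apply: IH => [s|s t l1 l2 x y st]; [apply: L0|apply: LL'; rewrite (inj_eq lift_inj)].
Qed.

End Limits.

(** * Generated algebras and the triangular decomposition *)

Section Generation.
Variables (F : fieldType) (A : algType F).

Lemma alg_gen_subalg (G : A -> Prop) : subalg (alg_gen G).
Proof.
split=> [c S [] //|x y Gx Gy S aS GS|x y Gx Gy S aS GS].
  by apply: subalgD => //; [apply: Gx|apply: Gy].
by apply: subalgM => //; [apply: Gx|apply: Gy].
Qed.

Lemma alg_gen_sub (G : A -> Prop) x : G x -> alg_gen G x.
Proof. by move=> Gx S _; apply. Qed.

Lemma alg_gen_comm (G H : A -> Prop) x y :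
  (forall x y, G x -> H y -> GRing.comm x y) ->
  alg_gen G x -> alg_gen H y -> GRing.comm x y.
Proof.
move=> GH Gx Hy; suff: forall y, H y -> GRing.comm x y.
  move=> xH; apply/commr_sym.
  have := Hy _ (commutant_subalg (eq x)); apply=> // z Hz _ <-.
  exact/commr_sym/xH.
by apply: Gx (commutant_subalg H) _ => z Gz w Hw; apply: GH.
Qed.

Lemma inv_unique (R : pzSemiRingType) n (X Y Z : 'M[R]_n) :
  Y *m X = 1%:M -> X *m Z = 1%:M -> Y = Z.
Proof. by move=> YX XZ; rewrite -[Y]mulmx1 -XZ mulmxA YX mul1mx. Qed.

(** Both [l] and [u'] have the diagonal [l i i], as [mx_in_lu] demands. In one direction, the square
    roots and inverses adjoined are diagonal entries of [l] or [u], hence already present. In the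
    other, [mx_in_lu] recovers [l] and [u'] from the product, and inverting [u'] gives [u]. The
    value 0 in the last hypothesis on [G] allows for the zero blocks around the product. *)
Lemma lu_generation n (rho rho' : 'I_n -> nat) (l u u' : 'M[A]_n) (c : F)
    (D E G : A -> Prop) :
  injective rho -> injective rho' ->
  (forall i j, (rho' i < rho' j)%N = (rho j < rho i)%N) ->
  triangular rho l -> triangular rho' u -> u *m u' = 1%:M -> u' *m u = 1%:M ->
  (forall i, l i i * u i i = 1) -> (forall i, u i i * l i i = 1) -> c != 0 ->
  (forall y, D y <-> diag_entries l y \/ diag_entries u y) ->
  (forall y, E y <-> entries l y \/ entries u y) ->
  (forall i j, G (c *: (l *m u') i j)) ->
  (forall y, G y -> y = 0 \/ exists i j, y = c *: (l *m u') i j) ->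
  forall x, alg_gen_sqrt_inv D G x <-> alg_gen E x.
Proof.
move=> rho_inj rho_inj' rhoE tl tu uu' u'u lu ul c0 DE EE Glu Gelim.
have [v [uv vu tv vd vS]] := triangular_inv rho_inj' tu ul lu.
have ev : v = u' by apply: inv_unique vu uu'.
subst v; split=> [DGx|Ex S aS Ssq Sinv SG].
  have aE := alg_gen_subalg E.
  have El i j : alg_gen E (l i j) by apply: alg_gen_sub; apply/EE; left; exists i, j.
  have Eu i j : alg_gen E (u i j) by apply: alg_gen_sub; apply/EE; right; exists i, j.
  apply: (DGx _ aE).
  - by move=> y /DE[] [i ->] _.
  - move=> y y' /DE Dy _ yy' _; case: Dy => -[i ey].
      suff -> : y' = u i i by [].
      by rewrite -[LHS]mul1r -(ul i) -mulrA -ey yy' mulr1.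
    suff -> : y' = l i i by [].
    by rewrite -[LHS]mul1r -(lu i) -mulrA -ey yy' mulr1.
  move=> y /Gelim[->|[i [j ->]]]; first exact: (subalg0 aE).
  apply: (subalgZ aE); suff: mx_in (alg_gen E) (l *m u') by exact.
  by apply: (mx_inM aE) => //; apply: vS.
have Dl i : D (l i i) by apply/DE; left; exists i.
have Slu : mx_in S (l *m u').
  move=> i j; rewrite -[_ i j]scale1r -(mulVf c0) -scalerA.
  by apply: subalgZ => //; apply: SG.
have Slu2 i : S (l i i) -> S (u i i).
  by move=> Sl; apply: (Sinv (l i i)).
have tv' i j : (rho j < rho i)%N -> u' i j = 0 by rewrite -rhoE => /tv.
have [Sl Su'] := mx_in_lu rho_inj aS tl tv' (fun=> erefl) vd lu ul
  (fun i => Ssq _ (Dl i)) Slu2 Slu.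
have [w [u'w wu' _ _ wS]] := @triangular_inv _ _ _ _ rho_inj' u' (fun i => u i i) tv
  (fun i => etrans (congr1 (fun y => y * u i i) (vd i)) (lu i))
  (fun i => etrans (congr1 (fun y => u i i * y) (vd i)) (ul i)).
have ew : w = u by apply: inv_unique wu' u'u.
apply: Ex => // y /EE[] [i [j ->]]; first exact: Sl.
by rewrite -ew; apply: wS => // k; apply: Slu2; apply: Sl.
Qed.

End Generation.

(** * The symmetry algebra *)

Section KMatrix.
Variables (F : fieldType) (m p : nat) (xi : F).
Hypothesis xi0 : xi != 0.

Definition Kdiag (k : nat) : 'rV[F]_(m + p) := \row_a (Kentry xi a)`_k.

(* The coefficients of u K^-1, where u = z^2: u / alpha = 1 / (u - xi^2) and
   u / beta = u / (1 - xi^2 u). *)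
Definition Kinv_coef (a k : nat) : F :=
  if (a < m)%N then - (xi ^- 2) ^+ k.+1
  else if k is j.+1 then (xi ^+ 2) ^+ j else 0.
Definition Kinv (k : nat) : 'rV[F]_(m + p) := \row_a Kinv_coef a k.

Lemma KentryE (a : 'I_(m + p)) k : (Kentry xi a)`_k =
  if (a < m)%N then (k == 2)%:R - xi ^+ 2 *+ (k == 1) else (k == 0)%:R - xi ^+ 2 *+ (k == 1).
Proof.
rewrite /Kentry; case: ifP => _.
  case: k => [|k]; first by rewrite coefXM /= subrr.
  by rewrite coefXM /= coefB coefX coefC !eqSS; case: (k == 0).
by rewrite coefB coef1 coefZ coefX mulr_natr.
Qed.

Lemma sum_Kentry (a : 'I_(m + p)) k :
  \sum_(i < k.+1) (Kentry xi a)`_i * Kinv_coef a (k - i) = (k == 1)%:R.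
Proof.
have x20 : xi ^+ 2 != 0 by rewrite expf_neq0.
case: k => [|[|k]].
- rewrite big_ord_recl big_ord0 /= KentryE /Kinv_coef.
  by case: ifP => _ /=; rewrite ?subrr ?mul0r ?mulr0 addr0.
- rewrite !big_ord_recl big_ord0 /= !KentryE /Kinv_coef.
  case: ifP => _ /=; rewrite ?subnn ?subn0 /bump /= ?mulr0n ?mulr1n ?expr1 ?expr0.
    by rewrite subrr mul0r sub0r mulrNN mulfV // !addr0 add0r.
  by rewrite subr0 mulr1 mulr0 !addr0.
rewrite 3!big_ord_recl big1 ?addr0 => [|i _]; last first.
  by rewrite KentryE /=; case: ifP => _ /=; rewrite ?mulr0n subrr mul0r.
rewrite !KentryE /Kinv_coef /= /bump /= !subSS !subn0.
case: ifP => _ /=; rewrite ?mulr0n ?mulr1n ?subr0 ?sub0r ?mul1r ?mul0r ?add0r ?addr0.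
  by rewrite mulNr mulrN opprK exprS mulrA mulfV // mul1r subrr.
by rewrite mulNr exprS subrr.
Qed.

Variable A : algType F.

Lemma smul_diag (u v : nat -> 'rV[F]_(m + p)) k :
  smul (fun i => scalmx A (diag_mx (u i))) (fun i => scalmx A (diag_mx (v i))) k =
  scalmx A (diag_mx (\row_a \sum_(i < k.+1) u i 0 a * v (k - i)%N 0 a)).
Proof.
rewrite /smul; under eq_bigr => i _ do rewrite -scalmxM mulmx_diag.
rewrite -scalmx_sum -raddf_sum; congr (scalmx A (diag_mx _)).
by apply/rowP => a; rewrite summxE !mxE; apply: eq_bigr => i _; rewrite !mxE.
Qed.

Local Notation Kser := (fun i => scalmx A (diag_mx (Kdiag i))).
Local Notation Hser := (fun i => scalmx A (diag_mx (Kinv i))).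

Lemma scalmx_smon d k : scalmx A (diag_mx (\row_(a < m + p) (k == d)%:R)) =
  smon A (m + p) d k.
Proof.
rewrite (_ : \row_a _ = const_mx (k == d)%:R); last by apply/rowP => a; rewrite !mxE.
rewrite diag_const_mx /smon; apply/matrixP => i j; rewrite scalmxE !mxE.
by case: (i == j); case: (k == d); rewrite ?mulr1n ?mulr0n ?scale1r ?scale0r.
Qed.

Lemma smul_K_Kinv : smul Kser Hser = smon A (m + p) 1.
Proof.
apply/funext => k; rewrite smul_diag -scalmx_smon; congr (scalmx A (diag_mx _)).
apply/rowP => a; rewrite !mxE -[RHS](sum_Kentry a k).
by apply: eq_bigr => i _; rewrite !mxE.
Qed.

Lemma smul_Kinv_K : smul Hser Kser = smon A (m + p) 1.
Proof.
rewrite -smul_K_Kinv; apply/funext => k; rewrite smul_rev /smul.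
apply: eq_bigr => i _; rewrite -!scalmxM; congr scalmx; exact: diag_mxC.
Qed.

(** The constant terms of K and of u K^-1 are supported on complementary blocks, which is why B(0)
    and Bhat(oo) see different halves of the level-zero generators. *)
Lemma Kser0 : Kser 0%N = block_mx 0 0 0 1%:M.
Proof.
apply/matrixP => i j; rewrite !mxE; case: split_ordP => i' ->; rewrite !mxE;
  case: split_ordP => j' ->; rewrite !mxE KentryE /= ?ltn_ord ?(ltnNge _ m) ?leq_addr /=;
  rewrite ?mulr0n ?subr0 ?scale0r ?mul0rn ?scale0r //.
- by rewrite eq_rlshift scale0r.
- by rewrite eq_shift; case: eqP => _; rewrite ?mulr1n ?scale1r ?scale0r.
Qed.

Lemma Hser0 : Hser 0%N = block_mx (- xi ^- 2)%:A%:M 0 0 0.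
Proof.
apply/matrixP => i j; rewrite !mxE; case: split_ordP => i' ->; rewrite !mxE;
  case: split_ordP => j' ->; rewrite !mxE /Kinv_coef /= ?ltn_ord ?(ltnNge _ m) ?leq_addr /=;
  rewrite ?expr1 ?mul0rn ?scale0r //.
- by rewrite eq_shift; case: eqP => _; rewrite ?mulr1n ?mulr0n ?scale0r.
- by rewrite eq_lrshift scale0r.
Qed.

End KMatrix.

(** * Consequences of the level-zero relations *)

Section LevelZero.
Variables (F : fieldType) (A : algType F) (q : F).
Hypothesis q0 : q != 0.

Lemma RLL0_all n e (X : 'M[A]_n) : e = 1 \/ e = -1 ->
  RLL0 (Rcoef q n e) X X -> forall k, RLL0 (Rcoef q n k) X X.
Proof.
move=> he RX k; have RXN := RLL0_sym q0 RX.
have [-> //|ke] := eqVneq k e; have [-> //|kNe] := eqVneq k (- e).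
rewrite Rcoef_eq0; first by rewrite /RLL0 (_ : scalmx A 0 = 0) ?mul0mx ?mulmx0 //; apply: map_mx0.
  by move=> k1; case: he ke kNe => ->; rewrite k1 ?opprK eqxx.
by move=> k1; case: he ke kNe => ->; rewrite k1 ?opprK eqxx.
Qed.

(** For i != k and j != h both diagonal coefficients equal [bcoef F e], whose square is 1. Once the
    two flip terms vanish, the relation is a commutation up to that factor. *)
Lemma RLL0_comm n e (X Y : 'M[A]_n) (i j k h : 'I_n) : e = 1 \/ e = -1 ->
  RLL0 (Rcoef q n e) X Y -> i != k -> j != h ->
  ~~ Rflip e i k \/ X k j = 0 \/ Y i h = 0 ->
  ~~ Rflip e h j \/ Y k j = 0 \/ X i h = 0 ->
  GRing.comm (X i j) (Y k h).
Proof.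
move=> he /RLL0E RXY ik jh H1 H2; have := RXY i k j h.
have -> : Roff q e i k *: (X k j * Y i h) = 0.
  by case: H1 => [/negPf e0|[]->]; rewrite ?mul0r ?mulr0 ?scaler0 // /Roff e0 scale0r.
have -> : Roff q e h j *: (Y k j * X i h) = 0.
  by case: H2 => [/negPf e0|[]->]; rewrite ?mul0r ?mulr0 ?scaler0 // /Roff e0 scale0r.
rewrite !addr0 /Rdiag !(inj_eq val_inj) (negPf ik) (negPf jh).
move/(congr1 (fun x => bcoef F e *: x)).
by rewrite !scalerA bcoef_sq // !scale1r.
Qed.

Lemma Uqgl_rel_block n r c (f : 'I_r -> 'I_n) (l u : 'M[A]_n) :
  (forall k, f k = (c + k)%N :> nat) ->
  Uqgl_rel q l u -> Uqgl_rel q (mxsub f f l) (mxsub f f u).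
Proof.
move=> fE [Rl Ru Rlu [lu0 lu1]]; split=> [k|k||].
- exact: (RLL0_block fE).
- exact: (RLL0_block fE).
- exact: (RLL0_block fE).
split=> [a b ab|a]; rewrite !mxE; last exact: lu1.
by apply: lu0; rewrite !fE ltn_add2l.
Qed.

End LevelZero.

Section Blocks.
Variables (m p : nat).

Lemma drsubmx_mxsub (T : Type) (X : 'M[T]_(m + p)) :
  drsubmx X = mxsub (@rshift m p) (@rshift m p) X.
Proof. by apply/matrixP => i j; rewrite !mxE. Qed.

Lemma ulsubmx_mxsub (T : Type) (X : 'M[T]_(m + p)) :
  ulsubmx X = mxsub (@lshift m p) (@lshift m p) X.
Proof. by apply/matrixP => i j; rewrite !mxE. Qed.

Lemma notin_codom_rshift (i : 'I_(m + p)) : i \notin codom (@rshift m p) -> (i < m)%N.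
Proof.
by case: (split_ordP i) => j ->; rewrite ?codom_f //= => _; apply: ltn_ord.
Qed.

Lemma notin_codom_lshift (i : 'I_(m + p)) : i \notin codom (@lshift m p) -> (m <= i)%N.
Proof.
by case: (split_ordP i) => j ->; rewrite ?codom_f //= => _; apply: leq_addr.
Qed.

Variables (F : fieldType) (A : algType F).

Lemma triangular_ursubmx (X : 'M[A]_(m + p)) : triangular val X -> ursubmx X = 0.
Proof.
move=> tX; apply/matrixP => i j; rewrite !mxE tX //=.
exact: leq_trans (ltn_ord i) (leq_addr _ _).
Qed.

Lemma triangular_dlsubmx (X : 'M[A]_(m + p)) :
  triangular (@revrank (m + p)) X -> dlsubmx X = 0.
Proof.
move=> tX; apply/matrixP => i j; rewrite !mxE tX // ltn_revrank /=.
exact: leq_trans (ltn_ord j) (leq_addr _ _).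
Qed.

Lemma mulmx_drsubmx (X Y : 'M[A]_(m + p)) : dlsubmx X = 0 ->
  X *m Y = 1%:M -> drsubmx X *m drsubmx Y = 1%:M.
Proof.
move=> X0; rewrite -{1}[X]submxK -{1}[Y]submxK X0 mulmx_block !mul0mx !add0r.
by rewrite scalar_mx_block => /eq_block_mx[].
Qed.

Lemma mulmx_ulsubmx (X Y : 'M[A]_(m + p)) : ursubmx X = 0 ->
  X *m Y = 1%:M -> ulsubmx X *m ulsubmx Y = 1%:M.
Proof.
move=> X0; rewrite -{1}[X]submxK -{1}[Y]submxK X0 mulmx_block !mul0mx !addr0.
by rewrite scalar_mx_block => /eq_block_mx[].
Qed.

End Blocks.

(* The auxiliary space has dimension m + p, with m the parameter of K(z). The N
   families (Lp s, Lm s), mutually commuting and each satisfying the defining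
   relations, amount to an arbitrary algebra morphism to A from the N-fold tensor
   power of the quantum affine algebra, which is itself one of the possible A.
   The condition xi != 0 is what makes z^-2 B(z^-1)^-1 a series in z^-2. *)
Theorem mainTheorem2 (F : fieldType) (A : algType F) (q xi theta0 : F)
    (m p N : nat) (Lp Lm : 'I_N -> nat -> 'M[A]_(m + p)) :
  q != 0 -> xi != 0 -> (theta0 = 1 \/ theta0 = -1) ->
  (forall s, Uqglhat_rel q (Lp s) (Lm s)) ->
  (forall (s t : 'I_N) (k l : nat) (x y : A), s != t ->
     entries (Lp s k) x \/ entries (Lm s k) x ->
     entries (Lp t l) y \/ entries (Lm t l) y -> GRing.comm x y) ->
  let Tp := monodromy Lp in
  let Tm := monodromy Lm in
  let B := openB xi Tp Tm in
  let Bhat := openBhat xi Tp Tm in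
  let b := transfer q theta0 B in
  [/\ forall (i j : 'I_(m + p)) (k : nat), GRing.comm (B 0%N i j) (b k),
      forall (i j : 'I_(m + p)) (k : nat), GRing.comm (Bhat 0%N i j) (b k)
    & Uqgl_sum_symmetry q (Tp 0%N) (Tm 0%N) (B 0%N) (Bhat 0%N) b].
Proof.
move=> q0 xi0 _ Lrel Lcomm Tp Tm B Bhat b.
have e1 : (1 : int) = 1 \/ (1 : int) = -1 by left.
have eN1 : (-1 : int) = 1 \/ (-1 : int) = -1 by right.
have L0 s := Uqglhat_level_zero q0 (Lrel s).
have Rpp k : RLL0 (Rcoef q _ 1) (Tp k) (Tp 0%N).
  apply: monodromy_RLL0 => [s l|s t l l' x y st Lx Ly]; first by case: (L0 s).
  by apply: Lcomm st _ _; [left; apply: Lx|left; apply: Ly].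
have Rmp k : RLL0 (Rcoef q _ 1) (Tm k) (Tp 0%N).
  apply: monodromy_RLL0 => [s l|s t l l' x y st Lx Ly]; first by case: (L0 s).
  by apply: Lcomm st _ _; [right; apply: Lx|left; apply: Ly].
have Rpm k : RLL0 (Rcoef q _ (-1)) (Tp k) (Tm 0%N).
  apply: monodromy_RLL0 => [s l|s t l l' x y st Lx Ly]; first by case: (L0 s).
  by apply: Lcomm st _ _; [left; apply: Lx|right; apply: Ly].
have Rmm k : RLL0 (Rcoef q _ (-1)) (Tm k) (Tm 0%N).
  apply: monodromy_RLL0 => [s l|s t l l' x y st Lx Ly]; first by case: (L0 s).
  by apply: Lcomm st _ _; [right; apply: Lx|right; apply: Ly].
have lz : level_zero (Tp 0%N) (Tm 0%N).
  apply: monodromy_level_zero => [s|s t l l' x y st Lx Ly]; first by case: (Lrel s).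
  by apply: Lcomm st _ _; [left; apply: Lx|right; apply: Ly].
have URel : Uqgl_rel q (Tp 0%N) (Tm 0%N).
  by split=> //; [exact: RLL0_all (Rpp _)|exact: RLL0_all (Rmm _)].
have /level_zero_triangular[tl tu lu ul] := lz.
(* The constant terms are triangular with invertible diagonals, so both monodromy series are
   invertible; [S] and [W] are the inverses of [Tm] and [Tp]. *)
have [u' [uu' u'u tu' u'd _]] := triangular_inv (@revrank_inj _) tu ul lu.
have [l' [ll' l'l tl' l'd _]] := triangular_inv val_inj tl lu ul.
have [S [S0 TmS STm]] := smul_unit uu' u'u.
have [W [W0 TpW WTp]] := smul_unit ll' l'l.
pose K i := scalmx A (diag_mx (Kdiag m p xi i)).
pose H i := scalmx A (diag_mx (Kinv m p xi i)).
have KH : smul K H = smon A _ 1 by apply: smul_K_Kinv.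
have HK : smul H K = smon A _ 1 by apply: smul_Kinv_K.
have BE : B = smul (smul Tp K) S by rewrite /B /openB (sinv_eq TmS STm).
(* B is inverted factor by factor, and [H] carries the factor u = z^2, so that the product with B is
   u. *)
have BhatE : Bhat = smul (smul Tm H) W.
  rewrite /Bhat /openBhat -/B BE; apply: sinv_eq.
    rewrite !smulA -(smulA _ S) STm smul_mon0 -(smulA _ K) KH.
    by rewrite smul_monC -smulA TpW smul_mon0.
  rewrite !smulA -(smulA _ W) WTp smul_mon0 -(smulA _ H) HK.
  by rewrite smul_monC -smulA TmS smul_mon0.
pose lm1 := drsubmx (Tp 0%N); pose lp1 := drsubmx (Tm 0%N).
pose lm2 := ulsubmx (Tp 0%N); pose lp2 := ulsubmx (Tm 0%N).
have dl_u := triangular_dlsubmx tu; have dl_u' := triangular_dlsubmx tu'.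
have ur_l := triangular_ursubmx tl; have ur_l' := triangular_ursubmx tl'.
have B0 : B 0%N = block_mx 0 0 0 (lm1 *m drsubmx u').
  rewrite BE !smul0 S0 /K Kser0 -[Tp 0%N]submxK -[u']submxK ur_l dl_u'.
  by rewrite !mulmx_block !block_mxKdr !(mulmx0, mul0mx, addr0, add0r, mulmx1).
have Bhat0 : Bhat 0%N = block_mx ((- xi ^- 2)%:A *: (lp2 *m ulsubmx l')) 0 0 0.
  rewrite BhatE !smul0 W0 /H Hser0 -[Tm 0%N]submxK -[l']submxK dl_u ur_l'.
  rewrite !mulmx_block !block_mxKul !(mulmx0, mul0mx, addr0, add0r).
  congr (block_mx _ 0 0 0); rewrite -/lp2.
  have -> : lp2 *m (- xi ^- 2)%:A%:M = (- xi ^- 2)%:A *: lp2.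
    by apply/matrixP => i j; rewrite mul_mx_scalE mulr_algr [RHS]mxE mulr_algl.
  by rewrite scalemxAl.
have comm_b r c (f : 'I_r -> 'I_(m + p)) (e : int) (Y : 'M[A]_(m + p)) i j k :
    (forall k, f k = (c + k)%N :> nat) -> (e = 1 \/ e = -1) ->
    (forall i k h, i \notin codom f -> ~~ Rflip e i (f k) \/ Y i (f h) = 0) ->
    (forall j k h, j \notin codom f -> ~~ Rflip e (f h) j \/ Y (f k) j = 0) ->
    (forall k, RLL0 (Rcoef q _ e) (Tp k) Y) -> (forall k, RLL0 (Rcoef q _ e) (Tm k) Y) ->
    (forall k a b, Kdiag m p xi k 0 (f a) = Kdiag m p xi k 0 (f b)) ->
    GRing.comm (Y (f i) (f j)) (b k).
  move=> fE he Ycol Yrow RTp RTm Kf; rewrite /b BE.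
  exact: (block_comm_transfer fE q0 he Ycol Yrow RTp RTm TmS STm Kf).
have Kr k a c : Kdiag m p xi k 0 (rshift m a) = Kdiag m p xi k 0 (rshift m c).
  by rewrite !mxE /Kentry /= !ltnNge !leq_addr.
have Kl k a c : Kdiag m p xi k 0 (lshift p a) = Kdiag m p xi k 0 (lshift p c).
  by rewrite !mxE /Kentry /= !ltn_ord.
have lt_rshift i (h : 'I_p) : i \notin codom (@rshift m p) -> (i < rshift m h)%N.
  by move/notin_codom_rshift => im; apply: leq_trans im (leq_addr _ _).
have lt_lshift i (h : 'I_m) : i \notin codom (@lshift m p) -> (lshift p h < i)%N.
  by move/notin_codom_lshift; apply: leq_trans (ltn_ord h).
(* For each of the four blocks, triangularity settles one of the two side conditions, and the
   direction of the flips in degree [e] the other. *)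
have lm1_b i j k : GRing.comm (lm1 i j) (b k).
  rewrite /lm1 drsubmx_mxsub mxE; apply: (comm_b _ m _ 1) => // [i' k' h /lt_rshift ih|i' k' h /lt_rshift ih].
    by right; apply: tl; apply: ih.
  by left; rewrite Rflip1 -leqNgt; apply/ltnW/ih.
have lp1_b i j k : GRing.comm (lp1 i j) (b k).
  rewrite /lp1 drsubmx_mxsub mxE; apply: (comm_b _ m _ (-1)) => // [i' k' h /lt_rshift ih|i' k' h /lt_rshift ih].
    by left; rewrite RflipN1 -leqNgt; apply/ltnW/ih.
  by right; apply: tu; rewrite ltn_revrank; apply: ih.
have lm2_b i j k : GRing.comm (lm2 i j) (b k).
  rewrite /lm2 ulsubmx_mxsub mxE; apply: (comm_b _ 0 _ 1) => // [i' k' h /lt_lshift ih|i' k' h /lt_lshift ih].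
    by left; rewrite Rflip1 -leqNgt; apply/ltnW/ih.
  by right; apply: tl; apply: ih.
have lp2_b i j k : GRing.comm (lp2 i j) (b k).
  rewrite /lp2 ulsubmx_mxsub mxE; apply: (comm_b _ 0 _ (-1)) => // [i' k' h /lt_lshift ih|i' k' h /lt_lshift ih].
    by right; apply: tu; rewrite ltn_revrank; apply: ih.
  by left; rewrite RflipN1 -leqNgt; apply/ltnW/ih.
have b1 x k : Uqgl_alg lm1 lp1 x -> GRing.comm x (b k).
  move=> Ux; apply: (Ux _ (commutant_subalg (eq (b k)))) => // y [] [i [j ->]] _ <-.
    exact: lm1_b.
  exact: lp1_b.
have b2 x k : Uqgl_alg lm2 lp2 x -> GRing.comm x (b k).
  move=> Ux; apply: (Ux _ (commutant_subalg (eq (b k)))) => // y [] [i [j ->]] _ <-.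
    exact: lm2_b.
  exact: lp2_b.
have gen1 x : alg_gen_sqrt_inv (fun y => diag_entries lm1 y \/ diag_entries lp1 y)
    (entries (B 0%N)) x <-> Uqgl_alg lm1 lp1 x.
  apply: (@lu_generation _ _ p val (@revrank p) lm1 lp1 (drsubmx u') 1) => //.
  - exact: val_inj.
  - exact: revrank_inj.
  - exact: ltn_revrank.
  - by move=> i j ij; rewrite !mxE; apply: tl; rewrite /= ltn_add2l.
  - move=> i j; rewrite ltn_revrank => ij; rewrite !mxE; apply: tu.
    by rewrite ltn_revrank /= ltn_add2l.
  - exact: mulmx_drsubmx.
  - exact: mulmx_drsubmx.
  - by move=> i; rewrite !mxE.
  - by move=> i; rewrite !mxE.
  - exact: oner_neq0.
  - move=> i j; exists (rshift m i), (rshift m j).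
    by rewrite scale1r B0 block_mxEdr.
  move=> y [i [j ->]]; rewrite B0.
  case: (split_ordP i) => i' ->; case: (split_ordP j) => j' ->.
  - by left; rewrite block_mxEul mxE.
  - by left; rewrite block_mxEur mxE.
  - by left; rewrite block_mxEdl mxE.
  by right; exists i', j'; rewrite block_mxEdr scale1r.
have gen2 x : alg_gen_sqrt_inv (fun y => diag_entries lm2 y \/ diag_entries lp2 y)
    (entries (Bhat 0%N)) x <-> Uqgl_alg lm2 lp2 x.
  (* The roles of l^- and l^+ are exchanged here, because Bhat(oo) is a multiple of l^+ (l^-)^-1. *)
  apply: (@lu_generation _ _ m (@revrank m) val lp2 lm2 (ulsubmx l') (- xi ^- 2)) => //.
  - exact: revrank_inj.
  - exact: val_inj.
  - by move=> i j; rewrite ltn_revrank.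
  - move=> i j; rewrite ltn_revrank => ij; rewrite !mxE; apply: tu.
    by rewrite ltn_revrank.
  - by move=> i j ij; rewrite !mxE; apply: tl.
  - exact: mulmx_ulsubmx.
  - exact: mulmx_ulsubmx.
  - by move=> i; rewrite !mxE.
  - by move=> i; rewrite !mxE.
  - by rewrite oppr_eq0 invr_eq0 expf_neq0.
  - by move=> y; split=> -[]; by [left|right].
  - by move=> y; split=> -[]; by [left|right].
  - move=> i j; exists (lshift p i), (lshift p j).
    by rewrite Bhat0 block_mxEul [RHS]mxE mulr_algl.
  move=> y [i [j ->]]; rewrite Bhat0.
  case: (split_ordP i) => i' ->; case: (split_ordP j) => j' ->.
  - by right; exists i', j'; rewrite block_mxEul [LHS]mxE mulr_algl.
  - by left; rewrite block_mxEur mxE.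
  - by left; rewrite block_mxEdl mxE.
  by left; rewrite block_mxEdr mxE.
split.
- by move=> i j k; apply/b1/gen1 => Z _ _ _; apply; exists i, j.
- by move=> i j k; apply/b2/gen2 => Z _ _ _; apply; exists i, j.
split=> //.
- split; rewrite ?drsubmx_mxsub ?ulsubmx_mxsub.
    exact: (@Uqgl_rel_block _ _ _ _ _ m).
  exact: (@Uqgl_rel_block _ _ _ _ _ 0).
(* Indices of the two blocks are always distinct, so [RLL0_comm] applies to the generators: one flip
   is excluded by the order of the blocks, the other meets a zero off-diagonal block. *)
- move=> x y; apply: alg_gen_comm => {x y}.
  have sh i (j : 'I_m) : rshift m (i : 'I_p) != lshift p j.
    by rewrite -val_eqE /= neq_ltn orbC (leq_trans (ltn_ord j) (leq_addr _ _)).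
  have lt_sh (i : 'I_p) (j : 'I_m) : (lshift p j < rshift m i)%N.
    exact: leq_trans (ltn_ord j) (leq_addr _ _).
  have l0 (i : 'I_p) (j : 'I_m) : Tp 0%N (lshift p j) (rshift m i) = 0.
    by apply: tl; apply: lt_sh.
  have u0 (i : 'I_p) (j : 'I_m) : Tm 0%N (rshift m i) (lshift p j) = 0.
    by apply: tu; rewrite ltn_revrank; apply: lt_sh.
  move=> x y [] [i [j ->]] [] [k [h ->]]; rewrite !mxE.
  + by apply: (RLL0_comm e1 (Rpp 0%N)) => //; [left; rewrite Rflip1 -leqNgt ltnW|right; left].
  + by apply: (RLL0_comm eN1 (Rpm 0%N)) => //; [right; left|left; rewrite RflipN1 -leqNgt ltnW].
  + apply/commr_sym; apply: (RLL0_comm eN1 (Rpm 0%N)); rewrite 1?eq_sym //.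
      by left; rewrite RflipN1 -leqNgt ltnW.
    by right; left.
  + by apply: (RLL0_comm eN1 (Rmm 0%N)) => //; [right; right|left; rewrite RflipN1 -leqNgt ltnW].
move=> x k Ux; apply: (Ux _ (commutant_subalg (eq (b k)))) => // y [Uy|Uy] _ <-.
  exact: b1.
exact: b2.
Qed.
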